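(* Let $\delta$ be a $|V_{\delta+\omega+2}|$-supercompact cardinal and let $\mathbb{P}$ be a tower of height $\delta$ such that for every $X \in V_\delta$ the filter $\mathcal{F}^{\mathbb{P}}_X$ equals $\mathcal{C}_X \restriction S_X$ for some stationary set $S_X \subseteq \mathcal{P}(X)$. Then $\mathbb{P}$ is precipitous.
   Context: A normal filter on $\mathcal{P}(X)$ is a family $\mathcal{F}\subseteq\mathcal{P}(\mathcal{P}(X))$ such that: (filter) $\mathcal{F}$ is closed under finite intersections and under supersets within $\mathcal{P}(X)$, and $\emptyset\notin\mathcal{F}$; (fineness) for each $x\in X$, $\{a\subseteq X: x\in a\}\in\mathcal{F}$; (normality) if $\mathcal{A}_x\in\mathcal{F}$ for all $x\in X$ then $\{a\subseteq X:\forall x\in a\,(a\in\mathcal{A}_x)\}\in\mathcal{F}$. Write $I_{\mathcal{F}}=\{\mathcal{A}\subseteq\mathcal{P}(X):\mathcal{P}(X)\setminus\mathcal{A}\in\mathcal{F}\}$ and $I^+_{\mathcal{F}}=\mathcal{P}(\mathcal{P}(X))\setminus I_{\mathcal{F}}$. For $Y\subseteq X$ the projection of $\mathcal{F}$ to $\mathcal{P}(Y)$ is $\{\{a\cap Y:a\in\mathcal{A}\}:\mathcal{A}\in\mathcal{F}\}$. A set $\mathcal{C}\subseteq\mathcal{P}(X)$ is club if there is $f:X^{<\omega}\to X$ with $\mathcal{C}=\{a\subseteq X: f''a^{<\omega}\subseteq a\}$; $\mathcal{C}_X$ is the filter on $\mathcal{P}(X)$ generated by the club sets; $S\subseteq\mathcal{P}(X)$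 is stationary if $S\in I^+_{\mathcal{C}_X}$, and then $\mathcal{C}_X\restriction S=\{\mathcal{B}\subseteq\mathcal{P}(X):\exists\mathcal{A}\in\mathcal{C}_X\,(\mathcal{A}\cap S\subseteq\mathcal{B})\}$. A tower of height $\delta$ ($\delta$ a limit ordinal) is a set $\mathbb{P}$ together with an assignment $X\mapsto\mathcal{F}^{\mathbb{P}}_X=\mathcal{F}_X$ ($X\in V_\delta$) of a normal filter on $\mathcal{P}(X)$ such that for $X\subseteq Y$ in $V_\delta$, $\mathcal{F}_Y$ projects to $\mathcal{F}_X$, and $\mathbb{P}=\{S\in V_\delta:\exists X\in V_\delta\,(S\in I^+_{\mathcal{F}_X})\}$, ordered by $S_1\le S_2$ iff $\bigcup S_1\supseteq\bigcup S_2$ and $a\cap\bigcup S_2\in S_2$ for all $a\in S_1$. If $G\subseteq\mathbb{P}$ is $V$-generic, let $G_X=\{S\in I^+_{\mathcal{F}_X}:S\in G\}$. The generic ultrapower is the direct limit: for $f_i:\mathcal{P}(X_i)\to V$ in $V$ ($X_i\in V_\delta$), $f_1\sim f_2$ iff for some $Z\in V_\delta$ with $X_1\cup X_2\subseteq Z$, $\{a\subseteq Z: f_1(a\cap X_1)=f_2(a\cap X_2)\}\in G_Z$, and $[f_1]\,E\,[f_2]$ iff $\{a\subseteq Z: f_1(a\cap X_1)\in f_2(a\cap X_2)\}\in G_Z$. $\mathbb{P}$ is precipitous if it is forced by $\mathbb{P}$ that this generic ultrapower is well-founded. $\lambda$-supercompact has its usual meaning. *)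

(* Defs.v *)
From Stdlib Require Import List ClassicalEpsilon.

Set Implicit Arguments.
Unset Strict Implicit.
Unset Printing Implicit Defensive.

(* The universe of sets: a model of ZFC in which separation and replacement
   hold for arbitrary predicates of the metatheory (second-order ZFC), so that
   Rocq functions and predicates on it play the role of classes. *)
Record universe : Type := Universe {
  carrier :> Type;
  mem : carrier -> carrier -> Prop;
  extensionality : forall x y,
    (forall z, mem z x <-> mem z y) -> x = y;
  foundation : forall x,
    (exists y, mem y x) -> exists y, mem y x /\ forall z, mem z x -> ~ mem z y;
  separation : forall x (phi : carrier -> Prop),
    exists y, forall z, mem z y <-> mem z x /\ phi z;
  pairing : forall x y,
    exists p, forall z, mem z p <-> z = x \/ z = y;
  union_ax : forall x,
    exists u, forall z, mem z u <-> exists y, mem y x /\ mem z y;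
  powerset : forall x,
    exists p, forall y, mem y p <-> (forall z, mem z y -> mem z x);
  infinity :
    exists x, (exists e, (forall z, ~ mem z e) /\ mem e x) /\
      forall y, mem y x ->
        exists s, mem s x /\ forall z, mem z s <-> mem z y \/ z = y;
  replacement : forall x (R : carrier -> carrier -> Prop),
    (forall y, mem y x -> forall z z', R y z -> R y z' -> z = z') ->
    exists w, forall z, mem z w <-> exists y, mem y x /\ R y z;
  choice_ax : forall x,
    (forall y, mem y x -> exists z, mem z y) ->
    (forall y y', mem y x -> mem y' x ->
       forall z, mem z y -> mem z y' -> y = y') ->
    exists c, forall y, mem y x -> exists! z, mem z y /\ mem z c
}.

Arguments mem {u} _ _.
Notation "x ∈ y" := (mem x y) (at level 70, no associativity).

Lemma universe_inhabited (M : universe) : inhabited M.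
Proof. destruct (infinity M) as [x _]; exact (inhabits x). Qed.

(* {x | phi x} when that class is a set, unspecified otherwise. *)
Definition setof (M : universe) (phi : M -> Prop) : M :=
  epsilon (universe_inhabited M) (fun x => forall y, y ∈ x <-> phi y).

Notation "⟦ x | phi ⟧" := (setof (fun x => phi))
  (at level 0, x name, phi at level 200).

Lemma in_setof (M : universe) (phi : M -> Prop) :
  (exists x, forall y, y ∈ x <-> phi y) ->
  forall y, y ∈ ⟦ z | phi z ⟧ <-> phi y.
Proof. intros H; exact (epsilon_spec (universe_inhabited M) _ H). Qed.

Section SetTheory.
Variable M : universe.
Implicit Types x y z f X Y Z A B S : M.

Definition sub x y : Prop := forall z, z ∈ x -> z ∈ y.
Local Infix "⊆" := sub (at level 70, no associativity).

Definition empty : M := ⟦ z | False ⟧.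
Definition pow x : M := ⟦ y | y ⊆ x ⟧.
Definition bigcup x : M := ⟦ z | exists y, y ∈ x /\ z ∈ y ⟧.
Definition cup x y : M := ⟦ z | z ∈ x \/ z ∈ y ⟧.
Definition cap x y : M := ⟦ z | z ∈ x /\ z ∈ y ⟧.
Definition diff x y : M := ⟦ z | z ∈ x /\ ~ z ∈ y ⟧.
Definition upair x y : M := ⟦ z | z = x \/ z = y ⟧.
Definition opair x y : M := upair (upair x x) (upair x y).

Definition function_on f X : Prop :=
  (forall z, z ∈ f -> exists x y, x ∈ X /\ z = opair x y) /\
  (forall x, x ∈ X -> exists! y, opair x y ∈ f).

(* The union of {y | (x,y) ∈ f}, which is the value when f is a function. *)
Definition app f x : M := ⟦ z | exists y, opair x y ∈ f /\ z ∈ y ⟧.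

Definition bijection f X Y : Prop :=
  function_on f X /\ (forall x, x ∈ X -> app f x ∈ Y) /\
  (forall y, y ∈ Y -> exists! x, x ∈ X /\ app f x = y).

Definition equinumerous X Y : Prop := exists f, bijection f X Y.

Definition transitive x : Prop := forall y, y ∈ x -> y ⊆ x.

Definition ordinal x : Prop :=
  transitive x /\ forall y, y ∈ x -> transitive y.

Definition succ x : M := ⟦ z | z ∈ x \/ z = x ⟧.

Definition limit_ordinal x : Prop :=
  ordinal x /\ (exists y, y ∈ x) /\ forall y, y ∈ x -> succ y ∈ x.

(* The ordinal sum x + ω, i.e. the supremum of the x + n. *)
Definition add_omega x : M := ⟦ z | exists n : nat, z ∈ Nat.iter n succ x ⟧.

Definition is_cardinality (lam : M) x : Prop :=
  ordinal lam /\ equinumerous lam x /\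
  forall alpha, alpha ∈ lam -> ~ equinumerous alpha x.

(* x ∈ V_alpha, from V_alpha = the union over beta < alpha of P(V_beta). *)
Inductive in_rank x (alpha : M) : Prop :=
  InRank : forall beta, beta ∈ alpha ->
    (forall y, y ∈ x -> in_rank y beta) -> in_rank x alpha.

Definition Vrank (alpha : M) : M := ⟦ x | in_rank x alpha ⟧.

(* Variables are de Bruijn indices. *)
Inductive formula : Type :=
  | FMem (i j : nat)
  | FEq (i j : nat)
  | FNot (phi : formula)
  | FAnd (phi psi : formula)
  | FEx (phi : formula).

Definition env_cons x (e : nat -> M) (n : nat) : M :=
  match n with O => x | S m => e m end.

Fixpoint sat (D : M -> Prop) (phi : formula) (e : nat -> M) : Prop :=
  match phi with
  | FMem i j => e i ∈ e j
  | FEq i j => e i = e j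
  | FNot phi => ~ sat D phi e
  | FAnd phi psi => sat D phi e /\ sat D psi e
  | FEx phi => exists x, D x /\ sat D phi (env_cons x e)
  end.

Definition elementary_embedding (N : M -> Prop) (j : M -> M) : Prop :=
  (forall x, N (j x)) /\
  forall (phi : formula) (e : nat -> M),
    sat (fun _ => True) phi e <-> sat N phi (fun n => j (e n)).

Definition critical_point (j : M -> M) (kappa : M) : Prop :=
  ordinal kappa /\ (forall alpha, alpha ∈ kappa -> j alpha = alpha) /\
  kappa ∈ j kappa.

Definition supercompact (kappa lam : M) : Prop :=
  exists (N : M -> Prop) (j : M -> M),
    (forall x y, N x -> y ∈ x -> N y) /\
    elementary_embedding N j /\
    critical_point j kappa /\
    lam ∈ j kappa /\
    (forall f, function_on f lam ->
       (forall alpha, alpha ∈ lam -> N (app f alpha)) -> N f).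

Record normal_filter X (F : M) : Prop := NormalFilter {
  nf_family : forall A, A ∈ F -> A ⊆ pow X;
  nf_cap : forall A B, A ∈ F -> B ∈ F -> cap A B ∈ F;
  nf_up : forall A B, A ∈ F -> A ⊆ B -> B ⊆ pow X -> B ∈ F;
  nf_proper : ~ empty ∈ F;
  nf_fine : forall x, x ∈ X -> ⟦ a | a ⊆ X /\ x ∈ a ⟧ ∈ F;
  nf_normal : forall A : M -> M, (forall x, x ∈ X -> A x ∈ F) ->
    ⟦ a | a ⊆ X /\ forall x, x ∈ a -> a ∈ A x ⟧ ∈ F
}.

Definition dual_ideal X (F : M) : M :=
  ⟦ A | A ⊆ pow X /\ diff (pow X) A ∈ F ⟧.

Definition positive X (F : M) : M := diff (pow (pow X)) (dual_ideal X F).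

Definition projection Y (F : M) : M :=
  ⟦ B | exists A, A ∈ F /\ B = ⟦ b | exists a, a ∈ A /\ b = cap a Y ⟧ ⟧.

(* Lists over M with entries in X represent X^{<ω}. *)
Definition club X (C : M) : Prop :=
  exists f : list M -> M,
    (forall s, Forall (fun x => x ∈ X) s -> f s ∈ X) /\
    C = ⟦ a | a ⊆ X /\ forall s, Forall (fun x => x ∈ a) s -> f s ∈ a ⟧.

(* The generated filter: supersets of finite intersections of club sets; the
   empty intersection is P(X), which matters for X = ∅, where no club exists. *)
Definition club_filter X : M :=
  ⟦ A | A ⊆ pow X /\
        exists Cs : list M, Forall (club X) Cs /\
          forall a, a ⊆ X -> Forall (fun C => a ∈ C) Cs -> a ∈ A ⟧.

Definition stationary X S : Prop := S ∈ positive X (club_filter X).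

Definition restrict X (F S : M) : M :=
  ⟦ B | B ⊆ pow X /\ exists A, A ∈ F /\ cap A S ⊆ B ⟧.

Record tower (delta P : M) (F : M -> M) : Prop := Tower {
  tower_limit : limit_ordinal delta;
  tower_normal : forall X, X ∈ Vrank delta -> normal_filter X (F X);
  tower_project : forall X Y, X ∈ Vrank delta -> Y ∈ Vrank delta ->
    X ⊆ Y -> projection X (F Y) = F X;
  tower_conditions :
    P = ⟦ S | S ∈ Vrank delta /\
              exists X, X ∈ Vrank delta /\ S ∈ positive X (F X) ⟧
}.

Definition tower_le (S1 S2 : M) : Prop :=
  bigcup S2 ⊆ bigcup S1 /\ forall a, a ∈ S1 -> cap a (bigcup S2) ∈ S2.

(* The forcing relation of a preorder (P, le). The interpretation of a
   statement of the forcing language is the predicate of the conditions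
   forcing it. *)

Section Forcing.
Variables (P : M) (le : M -> M -> Prop).
Implicit Types p q r : M.

Inductive is_name (tau : M) : Prop :=
  IsName : (forall z, z ∈ tau ->
              exists sigma p, z = opair sigma p /\ p ∈ P /\ is_name sigma) ->
           is_name tau.

(* Recursion on names; as membership is well-founded, the inductive predicates
   are the unique solutions of the recursive clauses. *)
Inductive forces_eq (s t p : M) : Prop :=
  ForcesEq :
    (forall u r q, opair u r ∈ s -> q ∈ P -> le q p -> le q r ->
       forces_mem u t q) ->
    (forall u r q, opair u r ∈ t -> q ∈ P -> le q p -> le q r ->
       forces_mem u s q) ->
    forces_eq s t p
with forces_mem (s t p : M) : Prop :=
  ForcesMem :
    (forall q, q ∈ P -> le q p ->
       exists q', q' ∈ P /\ le q' q /\
         exists u r, opair u r ∈ t /\ le q' r /\ forces_eq s u q') ->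
    forces_mem s t p.

Definition forcing_statement : Type := M -> Prop.
Implicit Types phi psi : forcing_statement.

Definition fnot phi : forcing_statement :=
  fun p => forall q, q ∈ P -> le q p -> ~ phi q.
Definition fand phi psi : forcing_statement := fun p => phi p /\ psi p.
Definition fimp phi psi : forcing_statement := fnot (fand phi (fnot psi)).
Definition fall (D : M -> Prop) (phi : M -> forcing_statement) :
  forcing_statement := fun p => forall x, D x -> phi x p.
Definition fex (D : M -> Prop) (phi : M -> forcing_statement) :
  forcing_statement :=
  fun p => forall q, q ∈ P -> le q p ->
    exists q', q' ∈ P /\ le q' q /\ exists x, D x /\ phi x q'.

(* "V satisfies Q", and quantification over the ground model V. *)
Definition fground (Q : Prop) : forcing_statement := fun _ => Q.
Definition fex_ground (phi : M -> forcing_statement) : forcing_statement :=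
  fex (fun _ => True) phi.

Definition fall_name := fall is_name.
Definition fex_name := fex is_name.

(* c = {(y̌, p) | y ∈ x, p ∈ P}: no top element of P is singled out. *)
Inductive is_check (x c : M) : Prop :=
  IsCheck :
    (forall z, z ∈ c ->
       exists y d p, y ∈ x /\ p ∈ P /\ z = opair d p /\ is_check y d) ->
    (forall y p, y ∈ x -> p ∈ P ->
       exists d, opair d p ∈ c /\ is_check y d) ->
    is_check x c.

Definition check x : M := epsilon (universe_inhabited M) (is_check x).

Definition generic_name : M := ⟦ z | exists p, p ∈ P /\ z = opair (check p) p ⟧.

Definition forced phi : Prop := forall p, p ∈ P -> phi p.

End Forcing.

Section GenericUltrapower.
Variables (delta P : M) (F : M -> M).

Local Notation feq := (forces_eq P tower_le).
Local Notation fmem := (forces_mem P tower_le).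
Local Notation fexV := (fex_ground P tower_le).
Local Notation "~' phi" := (fnot P tower_le phi) (at level 75, right associativity).
Local Infix "/\'" := fand (at level 80, right associativity).
Local Infix "->'" := (fimp P tower_le) (at level 99, right associativity).

(* f : P(X) → V with X ∈ V_delta. *)
Definition ultra_function X f : Prop :=
  X ∈ Vrank delta /\ function_on f (pow X).

Definition in_G_at Z S : forcing_statement :=
  fground (S ∈ positive Z (F Z)) /\' fmem (check P S) (generic_name P).

Definition in_ultrapower (t : M) : forcing_statement :=
  fexV (fun X => fexV (fun f =>
    fground (ultra_function X f) /\' feq t (check P f))).

Definition ultra_E (t1 t2 : M) : forcing_statement :=
  fexV (fun X1 => fexV (fun f1 => fexV (fun X2 => fexV (fun f2 =>
    fground (ultra_function X1 f1 /\ ultra_function X2 f2) /\'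
    feq t1 (check P f1) /\' feq t2 (check P f2) /\'
    fexV (fun Z =>
      fground (Z ∈ Vrank delta /\ cup X1 X2 ⊆ Z) /\'
      in_G_at Z
        ⟦ a | a ⊆ Z /\ app f1 (cap a X1) ∈ app f2 (cap a X2) ⟧))))).

(* Every nonempty set of elements of the ultrapower has an E-minimal element.
   E depends only on the classes [f], so representatives may be used. *)
Definition ultrapower_wellfounded : forcing_statement :=
  fall_name P (fun A =>
    (fex_name P tower_le (fun t => fmem t A) /\'
     fall_name P (fun t => fmem t A ->' in_ultrapower t))
    ->'
    fex_name P tower_le (fun t =>
      fmem t A /\' fall_name P (fun u => fmem u A ->' ~' ultra_E u t))).

Definition precipitous : Prop := forced P ultrapower_wellfounded.

End GenericUltrapower.
End SetTheory.

(* Main.v *)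
(* Write X = V_(delta+omega) and let j : V -> N be the embedding. As N is closed
   under |P(P(X))|-sequences, the filter of j(P) at X is the true club filter on
   P(X) restricted to a stationary set S. If a set B of elements of S is
   stationary, it is therefore a condition of j(P), so in N it can be extended
   below any dense set, and reflecting such an extension with j gives, for almost
   every a in S, elements a' of S that meet a given dense set of P, agree with a
   on a given set in V_delta, and contain a given countable subset of a.
   Membership in a club is such a countable requirement: since delta+omega has
   cofinality omega, a function on X is the union of countably many elements of
   X, and a set closed under application that contains all of them is closed
   under the function. So the extension property of a is inherited by a', and
   iterating omega times yields one a meeting all the conditions T_n that decide
   a putative descending sequence [f_n] of the generic ultrapower; then the sets
   f_n(a), suitably restricted, form a descending sequence for membership. *)

From Stdlib Require Import List Classical ClassicalEpsilon Lia.
Require Import Defs.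

Set Implicit Arguments.
Unset Strict Implicit.
Unset Printing Implicit Defensive.

Local Infix "⊆" := sub (at level 70, no associativity).

(** * Elementary set theory *)

Section Elementary.
Variable M : universe.
Implicit Types x y z a b c d f p A B X Y : M.

(** Elementarity concerns sets and first-order formulas, whereas [F], [Vrank] and the tree of
    attempted descending sequences live in the metatheory. Each is therefore replaced by a set, or
    by a property of sets, before [j] is applied: the hypothesis on [F] by the property [guides] of
    [P], the hierarchy by its graph, the tree by a table of its nodes. The tree has to branch over
    all conditions: the move B made in j(P) is not a condition of [P], so the answer to it comes
    from j of the table, and for this the table must hold an answer to every move beforehand. The
    argument is thus a game, in which arbitrary conditions alternate with the answers of a fixed
    strategy.

    Countability is what makes a request on a reflect. The extension of a that is found in N
    contains j(x) for each x in a, and when x runs over a countable set E these j(x) form all of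
    j(E), as the critical point is uncountable. *)

Definition is_set (phi : M -> Prop) : Prop := exists x, forall y, y ∈ x <-> phi y.

Lemma is_set_sub (phi : M -> Prop) x : (forall y, phi y -> y ∈ x) -> is_set phi.
Proof.
intros H; destruct (separation x phi) as [y Hy]; exists y; intros z; rewrite Hy.
split; [tauto | intros Hz; split; auto].
Qed.

Lemma is_set_image x (G : M -> M) : is_set (fun z => exists y, y ∈ x /\ z = G y).
Proof.
apply replacement; intros y _ z z' -> ->; reflexivity.
Qed.

Lemma in_empty z : ~ z ∈ empty M.
Proof.
unfold empty; rewrite in_setof; [tauto|].
destruct (universe_inhabited M) as [x]; apply is_set_sub with x; tauto.
Qed.

Lemma in_pow x y : y ∈ pow x <-> y ⊆ x.
Proof. unfold pow; rewrite in_setof; [tauto | apply powerset]. Qed.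

Lemma in_bigcup x z : z ∈ bigcup x <-> exists y, y ∈ x /\ z ∈ y.
Proof. unfold bigcup; rewrite in_setof; [tauto | apply union_ax]. Qed.

Lemma in_upair x y z : z ∈ upair x y <-> z = x \/ z = y.
Proof. unfold upair; rewrite in_setof; [tauto | apply pairing]. Qed.

Lemma in_cup x y z : z ∈ cup x y <-> z ∈ x \/ z ∈ y.
Proof.
unfold cup; rewrite in_setof; [tauto|].
apply is_set_sub with (bigcup (upair x y)); intros w H.
apply in_bigcup; destruct H as [H|H];
  [exists x | exists y]; split; auto; apply in_upair; auto.
Qed.

Lemma in_cap x y z : z ∈ cap x y <-> z ∈ x /\ z ∈ y.
Proof.
unfold cap; rewrite in_setof; [tauto|].
apply is_set_sub with x; tauto.
Qed.

Lemma in_diff x y z : z ∈ diff x y <-> z ∈ x /\ ~ z ∈ y.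
Proof.
unfold diff; rewrite in_setof; [tauto|].
apply is_set_sub with x; tauto.
Qed.

Lemma in_powsep X (phi : M -> Prop) z : z ∈ ⟦ a | a ⊆ X /\ phi a ⟧ <-> z ⊆ X /\ phi z.
Proof.
rewrite in_setof; [tauto|]; apply is_set_sub with (pow X); intros w [H _].
apply in_pow, H.
Qed.

Definition sep X (phi : M -> Prop) : M := ⟦ z | z ∈ X /\ phi z ⟧.

Lemma in_sep X (phi : M -> Prop) z : z ∈ sep X phi <-> z ∈ X /\ phi z.
Proof.
unfold sep; rewrite in_setof; [tauto|]; apply is_set_sub with X; tauto.
Qed.

Definition image X (G : M -> M) : M := ⟦ z | exists y, y ∈ X /\ z = G y ⟧.

Lemma in_image X (G : M -> M) z : z ∈ image X G <-> exists y, y ∈ X /\ z = G y.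
Proof. unfold image; rewrite in_setof; [tauto | apply is_set_image]. Qed.

Lemma in_succ x z : z ∈ succ x <-> z ∈ x \/ z = x.
Proof.
unfold succ; rewrite in_setof; [tauto|].
apply is_set_sub with (cup x (upair x x)); intros w H.
apply in_cup; rewrite in_upair; tauto.
Qed.

Lemma sub_antisym x y : x ⊆ y -> y ⊆ x -> x = y.
Proof. intros H1 H2; apply extensionality; split; auto. Qed.

Lemma pow_inj x y : pow x = pow y -> x = y.
Proof.
intros H; apply sub_antisym.
- apply in_pow; rewrite <- H; apply in_pow; intros z; auto.
- apply in_pow; rewrite H; apply in_pow; intros z; auto.
Qed.

Lemma upair_inj x y x' y' :
  upair x y = upair x' y' -> (x = x' /\ y = y') \/ (x = y' /\ y = x').
Proof.
intros H.
assert (E : forall z, (z = x \/ z = y) <-> (z = x' \/ z = y'))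
  by (intros z; rewrite <- !in_upair, H; tauto).
destruct (proj1 (E x) (or_introl eq_refl)), (proj1 (E y) (or_intror eq_refl)),
  (proj2 (E x') (or_introl eq_refl)), (proj2 (E y') (or_intror eq_refl));
  subst; auto.
Qed.

Lemma opair_inj x y x' y' : opair x y = opair x' y' -> x = x' /\ y = y'.
Proof.
unfold opair; intros H; apply upair_inj in H.
destruct H as [[H1 H2] | [H1 H2]]; apply upair_inj in H1, H2;
  destruct H1 as [[? ?]|[? ?]], H2 as [[? ?]|[? ?]]; subst; auto.
Qed.

Lemma opair_nonempty x y : opair x y <> empty M.
Proof.
intros H; apply (@in_empty (upair x x)); rewrite <- H; apply in_upair; auto.
Qed.

Lemma mem_irrefl x : ~ x ∈ x.
Proof.
intros H; destruct (@foundation M (upair x x)) as [y [Hy Hn]].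
- exists x; apply in_upair; auto.
- apply in_upair in Hy; assert (y = x) as -> by tauto.
  apply (Hn x); [apply in_upair|]; auto.
Qed.

Definition num (n : nat) : M := Nat.iter n (@succ M) (empty M).

Lemma iter_succ_mem d n m : n < m -> Nat.iter n (@succ M) d ∈ Nat.iter m (@succ M) d.
Proof.
induction 1; cbn; apply in_succ; auto.
Qed.

Lemma num_inj n m : num n = num m -> n = m.
Proof.
intros H; destruct (Compare_dec.lt_eq_lt_dec n m) as [[L|E]|L]; auto;
  apply (iter_succ_mem (empty M)) in L; unfold num in H;
  [rewrite H in L | rewrite <- H in L]; destruct (mem_irrefl L).
Qed.

Lemma is_set_num : is_set (fun z => exists n, z = num n).
Proof.
destruct (infinity M) as [I [[e [He HeI]] HS]].
apply is_set_sub with I; intros y [n ->].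
induction n as [|n IH].
- replace (num 0) with e; auto; apply extensionality; intros z; split.
  + intros Hz; destruct (He z Hz).
  + intros Hz; destruct (in_empty Hz).
- destruct (HS _ IH) as [s [Hs Es]].
  replace (num (S n)) with s; auto; apply extensionality; intros z.
  rewrite Es; symmetry; apply in_succ.
Qed.

Definition range (g : nat -> M) : M := ⟦ z | exists n, z = g n ⟧.

Lemma in_range (g : nat -> M) z : z ∈ range g <-> exists n, z = g n.
Proof.
unfold range; rewrite in_setof; [tauto|].
destruct is_set_num as [w Hw].
destruct (@replacement M w (fun y z => exists n, y = num n /\ z = g n)) as [r Hr].
- intros y _ u v [n [-> ->]] [m [E ->]]; apply num_inj in E; subst; auto.
- exists r; intros y; rewrite Hr; split.
  + intros [u [_ [n [_ ->]]]]; exists n; auto.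
  + intros [n ->]; exists (num n); split; [apply Hw|]; exists n; auto.
Qed.

Definition lim (g : nat -> M) : M := bigcup (range g).

Lemma in_lim (g : nat -> M) z : z ∈ lim g <-> exists n, z ∈ g n.
Proof.
unfold lim; rewrite in_bigcup; split.
- intros [y [Hy Hz]]; apply in_range in Hy; destruct Hy as [n ->]; eauto.
- intros [n Hn]; exists (g n); split; auto; apply in_range; eauto.
Qed.

Lemma in_add_omega d z : z ∈ add_omega d <-> exists n, z ∈ Nat.iter n (@succ M) d.
Proof.
unfold add_omega; rewrite in_setof; [tauto|].
exists (lim (fun n => Nat.iter n (@succ M) d)); intros y; apply in_lim.
Qed.

Lemma mem_wf x : Acc mem x.
Proof.
apply NNPP; intros Hx.
(* Foundation applies to sets only, so the inaccessible elements are collected within the transitive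
   closure of x, the union of its iterated unions. *)
set (t := lim (fun n => Nat.iter n (@bigcup M) x)).
destruct (@foundation M (sep (cup t (upair x x)) (fun z => ~ Acc mem z)))
  as [y [Hy Hmin]].
- exists x; apply in_sep; split; auto; apply in_cup; rewrite in_upair; auto.
- apply in_sep in Hy; destruct Hy as [Hy Hna]; apply Hna; constructor; intros z Hz.
  apply NNPP; intros Hnz; apply (Hmin z); auto.
  apply in_sep; split; auto; apply in_cup; left; apply in_lim.
  apply in_cup in Hy; destruct Hy as [Hy|Hy].
  + apply in_lim in Hy; destruct Hy as [n Hn]; exists (S n); apply in_bigcup; eauto.
  + apply in_upair in Hy; exists 0; assert (y = x) as -> by tauto; auto.
Qed.

Lemma mem_ind (Q : M -> Prop) : (forall x, (forall y, y ∈ x -> Q y) -> Q x) -> forall x, Q x.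
Proof. intros H x; induction (mem_wf x); auto. Qed.

Lemma no_descending (g : nat -> M) : ~ forall n, g (S n) ∈ g n.
Proof.
intros H.
assert (E : forall x n, g n <> x); [|apply (E (g 0) 0); auto].
apply (mem_ind (Q := fun x => forall n, g n <> x)); intros x IH n <-.
apply (IH _ (H n) (S n)); auto.
Qed.

Lemma mem_asym x y : x ∈ y -> ~ y ∈ x.
Proof.
revert y; apply (mem_ind (Q := fun x => forall y, x ∈ y -> ~ y ∈ x)).
intros u IH y H1 H2; apply (IH y H2 u); auto.
Qed.

Lemma app_eq f x y :
  opair x y ∈ f -> (forall y', opair x y' ∈ f -> y' = y) -> app f x = y.
Proof.
intros H Hu; apply extensionality; intros z; unfold app; rewrite in_setof.
- split; [intros [y' [H1 H2]]; rewrite <- (Hu _ H1); auto | intros Hz; eauto].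
- apply is_set_sub with y; intros w [y' [H1 H2]]; rewrite <- (Hu _ H1); auto.
Qed.

Lemma app_pair f X x : function_on f X -> x ∈ X -> opair x (app f x) ∈ f.
Proof.
intros [_ H] Hx; destruct (H x Hx) as [y [Hy Hu]].
rewrite (@app_eq f x y); auto; intros y' Hy'; symmetry; auto.
Qed.

(** The bound depends neither on x nor on f being a function, so any V_a of limit height that
    contains f contains [app f x] for every x. *)
Lemma in_app_bigcup f x z : z ∈ app f x -> z ∈ bigcup (bigcup (bigcup f)).
Proof.
assert (E : forall z, (exists y, opair x y ∈ f /\ z ∈ y) -> z ∈ bigcup (bigcup (bigcup f))).
- intros w [y [Hy Hw]]; apply in_bigcup; exists y; split; auto.
  apply in_bigcup; exists (upair x y); split; [|apply in_upair; auto].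
  apply in_bigcup; exists (opair x y); split; auto; apply in_upair; auto.
- unfold app; rewrite in_setof; auto; apply is_set_sub with (1 := E).
Qed.

Definition graph X (G : M -> M) : M := image X (fun x => opair x (G x)).

Lemma in_graph X (G : M -> M) x y : opair x y ∈ graph X G <-> x ∈ X /\ y = G x.
Proof.
unfold graph; rewrite in_image; split.
- intros [x' [Hx E]]; apply opair_inj in E; destruct E as [-> ->]; auto.
- intros [Hx ->]; eauto.
Qed.

Lemma graph_function X (G : M -> M) : function_on (graph X G) X.
Proof.
split.
- intros z Hz; apply in_image in Hz; destruct Hz as [x [Hx ->]]; eauto.
- intros x Hx; exists (G x); split; [apply in_graph; auto|].
  intros y Hy; apply in_graph in Hy; symmetry; tauto.
Qed.

Lemma app_graph X (G : M -> M) x : x ∈ X -> app (graph X G) x = G x.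
Proof.
intros Hx; apply app_eq; [apply in_graph; auto|].
intros y Hy; apply in_graph in Hy; tauto.
Qed.

Lemma function_on_domain f X Y : function_on f X -> function_on f Y -> X = Y.
Proof.
assert (H : forall X Y, function_on f X -> function_on f Y -> X ⊆ Y).
- intros X' Y' HX [HY _] x Hx; apply (app_pair HX) in Hx.
  destruct (HY _ Hx) as [x' [y' [Hx' E]]]; apply opair_inj in E; destruct E as [-> _]; auto.
- intros; apply sub_antisym; auto.
Qed.

(** * Ordinals and the cumulative hierarchy *)

Lemma ordinal_mem a b : ordinal a -> b ∈ a -> ordinal b.
Proof.
intros [Ht He] Hb; split; auto; intros c Hc; apply He, (Ht b Hb), Hc.
Qed.

Lemma ordinal_trichotomy a : ordinal a -> forall b, ordinal b -> a ∈ b \/ a = b \/ b ∈ a.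
Proof.
apply (mem_ind (Q := fun a => ordinal a -> forall b, ordinal b -> a ∈ b \/ a = b \/ b ∈ a)).
clear a; intros a IHa Ha b.
apply (mem_ind (Q := fun b => ordinal b -> a ∈ b \/ a = b \/ b ∈ a)).
clear b; intros b IHb Hb.
destruct (classic (a ∈ b)) as [|Hab]; auto.
destruct (classic (b ∈ a)) as [|Hba]; auto.
right; left; apply sub_antisym; intros z Hz.
- destruct (IHa z Hz (ordinal_mem Ha Hz) b Hb) as [H|[->|H]]; auto; [tauto|].
  destruct Hba; apply (proj1 Ha z Hz); auto.
- destruct (IHb z Hz (ordinal_mem Hb Hz)) as [H|[<-|H]]; auto; [|tauto].
  destruct Hab; apply (proj1 Hb z Hz); auto.
Qed.

Lemma ordinal_mem_or_sub a b : ordinal a -> ordinal b -> a ∈ b \/ b ⊆ a.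
Proof.
intros Ha Hb; destruct (ordinal_trichotomy Ha Hb) as [H|[->|H]]; auto.
- right; intros z; auto.
- right; apply (proj1 Ha); auto.
Qed.

Lemma ordinal_succ a : ordinal a -> ordinal (succ a).
Proof.
intros [Ht He]; split.
- intros y Hy z Hz; apply in_succ; apply in_succ in Hy; destruct Hy as [Hy| ->]; auto.
  left; apply (Ht y); auto.
- intros y Hy; apply in_succ in Hy; destruct Hy as [Hy| ->]; auto.
Qed.

Lemma ordinal_iter_succ a n : ordinal a -> ordinal (Nat.iter n (@succ M) a).
Proof. intros Ha; induction n; cbn; auto using ordinal_succ. Qed.

Lemma iter_succ_in_add_omega a n : Nat.iter n (@succ M) a ∈ add_omega a.
Proof. apply in_add_omega; exists (S n); apply in_succ; auto. Qed.

Lemma add_omega_limit a : ordinal a -> limit_ordinal (add_omega a).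
Proof.
intros Ha; split; [split|split].
- intros y Hy z Hz; apply in_add_omega in Hy; destruct Hy as [n Hn].
  apply in_add_omega; exists n; apply (proj1 (ordinal_iter_succ n Ha) y); auto.
- intros y Hy; apply in_add_omega in Hy; destruct Hy as [n Hn].
  apply (proj2 (ordinal_iter_succ n Ha)); auto.
- exists a; apply (iter_succ_in_add_omega a 0).
- intros y Hy; apply in_add_omega in Hy; destruct Hy as [n Hn].
  assert (Hs : succ y ∈ succ (Nat.iter n (@succ M) a)).
  + apply in_succ.
    destruct (ordinal_trichotomy (ordinal_succ (ordinal_mem (ordinal_iter_succ n Ha) Hn))
                (ordinal_iter_succ n Ha)) as [H|[H|H]]; auto.
    apply in_succ in H; destruct H as [H|H];
      [destruct (mem_asym H Hn) | rewrite H in Hn; destruct (mem_irrefl Hn)].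
  + apply in_add_omega; exists (S n); auto.
Qed.

Lemma in_rank_iff x a :
  in_rank x a <-> exists b, b ∈ a /\ forall y, y ∈ x -> in_rank y b.
Proof.
split; [intros [b Hb H]; eauto | intros [b [Hb H]]; econstructor; eauto].
Qed.

(** [Vrank] is specified only once its class is known to be a set. This goes by induction on a,
    writing V_a as the union of the P(V_b) with b in a. *)
Lemma in_Vrank x a : x ∈ Vrank a <-> in_rank x a.
Proof.
unfold Vrank; rewrite in_setof; [tauto|]; revert a.
apply (mem_ind (Q := fun a => is_set (fun x => in_rank x a))); clear x; intros a IH.
exists (bigcup (image a (fun b => pow (Vrank b)))); intros x.
rewrite in_bigcup, in_rank_iff; split.
- intros [u [Hu Hx]]; apply in_image in Hu; destruct Hu as [b [Hb ->]].
  exists b; split; auto; intros y Hy; apply in_pow in Hx; apply Hx in Hy.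
  unfold Vrank in Hy; rewrite in_setof in Hy; auto; apply IH; auto.
- intros [b [Hb Hx]]; exists (pow (Vrank b)); split; [apply in_image; eauto|].
  apply in_pow; intros y Hy; unfold Vrank; rewrite in_setof; auto; apply IH; auto.
Qed.

Lemma in_Vrank_sub x a : x ∈ Vrank a <-> exists b, b ∈ a /\ x ⊆ Vrank b.
Proof.
rewrite in_Vrank, in_rank_iff; split; intros [b [Hb H]]; exists b; split; auto;
  intros y Hy; apply in_Vrank; auto.
Qed.

Lemma Vrank_mono a b : a ⊆ b -> Vrank a ⊆ Vrank b.
Proof.
intros H x Hx; apply in_Vrank_sub in Hx; destruct Hx as [c [Hc Hx]].
apply in_Vrank_sub; eauto.
Qed.

Lemma Vrank_sub_closed a x y : x ∈ Vrank a -> y ⊆ x -> y ∈ Vrank a.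
Proof.
intros Hx H; apply in_Vrank_sub in Hx; destruct Hx as [c [Hc Hx]].
apply in_Vrank_sub; exists c; split; auto; intros z Hz; auto.
Qed.

Lemma Vrank_trans a : transitive a -> transitive (Vrank a).
Proof.
intros Ha x Hx y Hy; apply in_Vrank_sub in Hx; destruct Hx as [c [Hc Hx]].
apply (@Vrank_mono c a); auto.
Qed.

Lemma Vrank_succ a x : x ⊆ Vrank a -> x ∈ Vrank (succ a).
Proof. intros H; apply in_Vrank_sub; exists a; split; auto; apply in_succ; auto. Qed.

Lemma ord_in_Vrank a x : x ∈ a -> x ∈ Vrank a.
Proof.
revert a; apply (mem_ind (Q := fun x => forall a, x ∈ a -> x ∈ Vrank a)).
clear x; intros x IH a Hx; apply in_Vrank_sub; exists x; split; auto; intros y Hy; auto.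
Qed.

Section Limit.
Variable a : M.
Hypothesis a_limit : limit_ordinal a.

Let a_ord : ordinal a.
Proof. apply a_limit. Qed.

Lemma Vrank_bound x : x ∈ Vrank a <-> exists b, b ∈ a /\ x ∈ Vrank b.
Proof.
split.
- intros Hx; apply in_Vrank_sub in Hx; destruct Hx as [b [Hb Hx]].
  exists (succ b); split; [apply a_limit | apply Vrank_succ]; auto.
- intros [b [Hb Hx]]; apply (@Vrank_mono b a); auto; apply (proj1 a_ord); auto.
Qed.

Lemma Vrank_bound2 x y : x ∈ Vrank a -> y ∈ Vrank a ->
  exists b, b ∈ a /\ x ∈ Vrank b /\ y ∈ Vrank b.
Proof.
intros Hx Hy; apply Vrank_bound in Hx, Hy.
destruct Hx as [b [Hb Hx]], Hy as [c [Hc Hy]].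
destruct (ordinal_trichotomy (ordinal_mem a_ord Hb) (ordinal_mem a_ord Hc))
  as [H|[<-|H]].
- exists c; split; [|split]; auto.
  apply (@Vrank_mono b c); auto; apply (proj1 (ordinal_mem a_ord Hc)); auto.
- exists b; auto.
- exists b; split; [|split]; auto.
  apply (@Vrank_mono c b); auto; apply (proj1 (ordinal_mem a_ord Hb)); auto.
Qed.

Lemma Vrank_pow x : x ∈ Vrank a -> pow x ∈ Vrank a.
Proof.
intros Hx; apply Vrank_bound in Hx; destruct Hx as [b [Hb Hx]].
apply in_Vrank_sub; exists b; split; auto; intros y Hy; apply in_pow in Hy.
apply (Vrank_sub_closed Hx Hy).
Qed.

Lemma Vrank_upair x y : x ∈ Vrank a -> y ∈ Vrank a -> upair x y ∈ Vrank a.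
Proof.
intros Hx Hy; destruct (Vrank_bound2 Hx Hy) as [b [Hb [H1 H2]]].
apply in_Vrank_sub; exists b; split; auto; intros z Hz; apply in_upair in Hz.
destruct Hz; subst; auto.
Qed.

Lemma Vrank_opair x y : x ∈ Vrank a -> y ∈ Vrank a -> opair x y ∈ Vrank a.
Proof. intros; apply Vrank_upair; apply Vrank_upair; auto. Qed.

Lemma Vrank_bigcup x : x ∈ Vrank a -> bigcup x ∈ Vrank a.
Proof.
intros Hx; apply in_Vrank_sub in Hx; destruct Hx as [b [Hb Hx]].
apply in_Vrank_sub; exists b; split; auto; intros z Hz; apply in_bigcup in Hz.
destruct Hz as [y [Hy Hz]]; apply (Vrank_trans (proj2 a_ord _ Hb) (Hx _ Hy)); auto.
Qed.

Lemma Vrank_cup x y : x ∈ Vrank a -> y ∈ Vrank a -> cup x y ∈ Vrank a.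
Proof.
intros Hx Hy; apply (@Vrank_sub_closed a (bigcup (upair x y))).
- apply Vrank_bigcup, Vrank_upair; auto.
- intros z Hz; apply in_cup in Hz; apply in_bigcup.
  destruct Hz; [exists x | exists y]; split; auto; apply in_upair; auto.
Qed.

Lemma Vrank_app f x : f ∈ Vrank a -> app f x ∈ Vrank a.
Proof.
intros Hf; apply (@Vrank_sub_closed a (bigcup (bigcup (bigcup f)))).
- auto using Vrank_bigcup.
- intros z; apply in_app_bigcup.
Qed.

Lemma empty_in_Vrank : empty M ∈ Vrank a.
Proof.
destruct a_limit as [_ [[y Hy] _]]; apply in_Vrank_sub; exists y; split; auto.
intros z Hz; destruct (in_empty Hz).
Qed.

End Limit.

Lemma opair_rank a x y : x ∈ Vrank a -> y ∈ Vrank a ->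
  opair x y ∈ Vrank (succ (succ a)).
Proof.
intros Hx Hy; apply Vrank_succ; intros z Hz; apply in_upair in Hz.
apply Vrank_succ; intros w Hw.
destruct Hz as [-> | ->]; apply in_upair in Hw; destruct Hw as [-> | ->]; auto.
Qed.

Lemma Vrank_add_omega d x : ordinal d ->
  x ∈ Vrank (add_omega d) <-> exists n, x ∈ Vrank (Nat.iter n (@succ M) d).
Proof.
intros Hd; rewrite (Vrank_bound (add_omega_limit Hd)); split.
- intros [b [Hb Hx]]; apply in_add_omega in Hb; destruct Hb as [n Hn]; exists n.
  apply (@Vrank_mono b); auto; apply (proj1 (ordinal_iter_succ n Hd)); auto.
- intros [n Hx]; eexists; split; eauto; apply iter_succ_in_add_omega.
Qed.

End Elementary.

(** * First-order definability and absoluteness *)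

Section Definability.
Variable M : universe.

(* Q D e is the relativization to the class D of a statement about e; below, the
   prefix r_ marks such relativizations. *)
Definition FO (Q : (M -> Prop) -> (nat -> M) -> Prop) : Prop :=
  exists phi, forall D e, sat D phi e <-> Q D e.

Lemma FO_mem i j : FO (fun _ e => e i ∈ e j).
Proof. exists (FMem i j); cbn; tauto. Qed.

Lemma FO_eq i j : FO (fun _ e => e i = e j).
Proof. exists (FEq i j); cbn; tauto. Qed.

Lemma FO_not Q : FO Q -> FO (fun D e => ~ Q D e).
Proof. intros [p Hp]; exists (FNot p); intros D e; cbn; rewrite Hp; tauto. Qed.

Lemma FO_and Q1 Q2 : FO Q1 -> FO Q2 -> FO (fun D e => Q1 D e /\ Q2 D e).
Proof.
intros [p Hp] [q Hq]; exists (FAnd p q); intros D e; cbn; rewrite Hp, Hq; tauto.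
Qed.

Lemma FO_imp Q1 Q2 : FO Q1 -> FO Q2 -> FO (fun D e => Q1 D e -> Q2 D e).
Proof.
intros [p Hp] [q Hq]; exists (FNot (FAnd p (FNot q))); intros D e; cbn.
rewrite Hp, Hq; tauto.
Qed.

Lemma FO_or Q1 Q2 : FO Q1 -> FO Q2 -> FO (fun D e => Q1 D e \/ Q2 D e).
Proof.
intros [p Hp] [q Hq]; exists (FNot (FAnd (FNot p) (FNot q))); intros D e; cbn.
rewrite Hp, Hq; tauto.
Qed.

Lemma FO_iff Q1 Q2 : FO Q1 -> FO Q2 -> FO (fun D e => Q1 D e <-> Q2 D e).
Proof. intros H1 H2; apply FO_and; apply FO_imp; auto. Qed.

Lemma FO_ex Q : FO (fun D e => Q D (e 0) (fun n => e (S n))) ->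
  FO (fun D e => exists x, D x /\ Q D x e).
Proof.
intros [p Hp]; exists (FEx p); intros D e; cbn.
split; intros [x [Hx H]]; exists x; split; auto;
  [apply Hp in H | apply Hp]; exact H.
Qed.

Lemma FO_all Q : FO (fun D e => Q D (e 0) (fun n => e (S n))) ->
  FO (fun D e => forall x, D x -> Q D x e).
Proof.
intros [p Hp]; exists (FNot (FEx (FNot p))); intros D e; cbn; split.
- intros H x Hx; apply NNPP; intros Hn; apply H; exists x; split; auto.
  rewrite Hp; exact Hn.
- intros H [x [Hx Hn]]; apply Hn; apply Hp; exact (H x Hx).
Qed.

Variable D : M -> Prop.

Definition r_sub (x y : M) : Prop := forall z, D z -> z ∈ x -> z ∈ y.

Definition r_upair (p x y : M) : Prop := forall z, D z -> (z ∈ p <-> z = x \/ z = y).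

Definition r_pair (p x y : M) : Prop :=
  exists u, D u /\ exists v, D v /\ r_upair u x x /\ r_upair v x y /\ r_upair p u v.

Definition r_mempair (R x y : M) : Prop := exists p, D p /\ p ∈ R /\ r_pair p x y.

Definition r_func (R X : M) : Prop :=
  forall x, D x -> x ∈ X -> forall y, D y -> forall y', D y' ->
    r_mempair R x y -> r_mempair R x y' -> y = y' /\ y ∈ X.

Definition r_closed (R a : M) : Prop :=
  forall x, D x -> forall y, D y -> x ∈ a -> r_mempair R x y -> y ∈ a.

Definition r_trace (U a : M) : Prop :=
  exists w, D w /\ w ∈ U /\
    forall z, D z -> (z ∈ w <-> z ∈ a /\ exists s, D s /\ s ∈ U /\ z ∈ s).

Definition r_le (S1 S2 : M) : Prop :=
  (forall s, D s -> s ∈ S2 -> forall z, D z -> z ∈ s ->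
     exists s', D s' /\ s' ∈ S1 /\ z ∈ s') /\
  (forall a, D a -> a ∈ S1 -> r_trace S2 a).

End Definability.

Section Absoluteness.
Variables (M : universe) (D : M -> Prop).
Implicit Types x y z a b p R U S X : M.

(** A partial function from X to X coded by a set of pairs; pairs whose first component is outside X
    are unrestricted. *)
Definition func R X : Prop :=
  forall x, x ∈ X -> forall y y', opair x y ∈ R -> opair x y' ∈ R -> y = y' /\ y ∈ X.

Definition closed R a : Prop := forall x y, x ∈ a -> opair x y ∈ R -> y ∈ a.

(** When U is a condition, [bigcup U] is the set Z at which it is positive, so this says that the
    projection of a to P(Z) falls into U. *)
Definition trace U a : Prop := cap a (bigcup U) ∈ U.

Definition class_transitive : Prop := forall x y, D x -> y ∈ x -> D y.

Hypothesis D_trans : class_transitive.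

(** Quantifiers bounded by sets range over the same objects in a transitive class as in the
    universe. Each such lemma serves twice around a transfer: with the full universe as [D] before
    it, and with the target model after it. *)
Lemma abs_sub x y : D x -> r_sub D x y <-> x ⊆ y.
Proof. intros Hx; split; intros H z Hz; auto; apply H; auto; apply (D_trans Hx Hz). Qed.

Lemma abs_upair p x y : D p -> D x -> D y -> r_upair D p x y <-> p = upair x y.
Proof.
intros Hp Hx Hy; split.
- intros H; apply extensionality; intros z; rewrite in_upair; split.
  + intros Hz; apply H; auto; apply (D_trans Hp Hz).
  + intros Hz; apply H; auto; destruct Hz; subst; auto.
- intros -> z _; apply in_upair.
Qed.

Lemma abs_pair p x y : D p -> D x -> D y -> r_pair D p x y <-> p = opair x y.
Proof.
intros Hp Hx Hy; split.
- intros [u [Hu [v [Hv [H1 [H2 H3]]]]]]; apply abs_upair in H1, H2, H3; subst; auto.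
- intros ->; exists (upair x x); split; [apply (D_trans Hp); apply in_upair; auto|].
  exists (upair x y); split; [apply (D_trans Hp); apply in_upair; auto|].
  split; [|split]; intros z _; apply in_upair.
Qed.

Lemma D_opair x y : D (opair x y) -> D x /\ D y.
Proof.
intros H; assert (H' : D (upair x y)) by (apply (D_trans H), in_upair; auto).
split; apply (D_trans H'), in_upair; auto.
Qed.

Lemma abs_mempair R x y : D R -> D x -> D y -> r_mempair D R x y <-> opair x y ∈ R.
Proof.
intros HR Hx Hy; split.
- intros [p [Hp [H1 H2]]]; apply abs_pair in H2; subst; auto.
- intros H; assert (Hp := D_trans HR H).
  exists (opair x y); split; [|split]; auto; apply abs_pair; auto.
Qed.

Lemma abs_func R X : D R -> D X -> r_func D R X <-> func R X.
Proof.
intros HR HX; split.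
- intros H x Hx y y' H1 H2.
  destruct (D_opair (D_trans HR H1)), (D_opair (D_trans HR H2)).
  apply (H x); auto; apply abs_mempair; auto.
- intros H x Dx Hx y Dy y' Dy' H1 H2; apply abs_mempair in H1, H2; eauto.
Qed.

Lemma abs_closed R a : D R -> r_closed D R a <-> closed R a.
Proof.
intros HR; split.
- intros H x y Hx Hy; destruct (D_opair (D_trans HR Hy)).
  apply (H x); auto; apply abs_mempair; auto.
- intros H x Dx y Dy Hx Hy; apply abs_mempair in Hy; eauto.
Qed.

Lemma abs_trace U a : D U -> D a -> r_trace D U a <-> trace U a.
Proof.
intros HU Ha.
assert (E : forall w, D w -> (forall z, D z ->
  (z ∈ w <-> z ∈ a /\ exists s, D s /\ s ∈ U /\ z ∈ s)) <-> w = cap a (bigcup U)).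
- intros w Hw; split.
  + intros H; apply extensionality; intros z; rewrite in_cap, in_bigcup; split.
    * intros Hz; apply H in Hz; [|apply (D_trans Hw Hz)].
      destruct Hz as [Hz [s [_ Hs]]]; eauto.
    * intros [Hz [s [Hs Hzs]]]; apply H; [apply (D_trans Ha Hz)|].
      split; auto; exists s; split; auto; apply (D_trans HU Hs).
  + intros -> z _; rewrite in_cap, in_bigcup; split; intros [Hz [s Hs]]; split; auto.
    * exists s; split; auto; apply (D_trans HU (proj1 Hs)).
    * exists s; tauto.
- unfold r_trace, trace; split.
  + intros [w [Dw [Hw H]]]; apply E in H; subst; auto.
  + intros H; assert (Dw := D_trans HU H); eexists; split; [exact Dw|].
    split; auto; apply E; auto.
Qed.

Lemma abs_le S1 S2 : D S1 -> D S2 -> r_le D S1 S2 <-> tower_le S1 S2.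
Proof.
intros H1 H2; unfold r_le, tower_le; split; intros [A B]; split.
- intros z Hz; apply in_bigcup in Hz; destruct Hz as [s [Hs Hz]].
  assert (Ds := D_trans H2 Hs); destruct (A s Ds Hs z (D_trans Ds Hz) Hz) as [s' [_ H]].
  apply in_bigcup; eauto.
- intros a Ha; apply abs_trace; auto; [|apply B; auto]; apply (D_trans H1 Ha).
- intros s Ds Hs z Dz Hz.
  assert (Hz' : z ∈ bigcup S1) by (apply A, in_bigcup; eauto).
  apply in_bigcup in Hz'; destruct Hz' as [s' [Hs' Hz']].
  exists s'; split; auto; apply (D_trans H1 Hs').
- intros a Da Ha; apply abs_trace; auto; apply B; auto.
Qed.

End Absoluteness.

Definition env (M : universe) (l : list M) (n : nat) : M := nth n l (empty M).

(** Quantifiers are recognized only as [exists x, D x /\ _] and [forall x, D x -> _], which is why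
    every relativized statement places the guard right after each single variable. *)
Ltac FO_tac :=
  cbv beta;
  lazymatch goal with
  | |- FO (fun _ e => e _ ∈ e _) => apply FO_mem
  | |- FO (fun _ e => e _ = e _) => apply FO_eq
  | |- FO (fun _ _ => _ <-> _) => simple apply FO_iff; FO_tac
  | |- FO (fun _ _ => _ /\ _) => simple apply FO_and; FO_tac
  | |- FO (fun _ _ => _ \/ _) => simple apply FO_or; FO_tac
  | |- FO (fun _ _ => ~ _) => simple apply FO_not; FO_tac
  | |- FO (fun D _ => exists x, D x /\ _) => simple apply FO_ex; FO_tac
  | |- FO (fun D _ => forall x, D x -> _) => simple apply FO_all; FO_tac
  | |- FO (fun _ _ => _ -> _) => simple apply FO_imp; FO_tac
  | |- _ => idtac
  end.

Ltac FO_solve :=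
  unfold r_le, r_trace, r_closed, r_func, r_mempair, r_pair, r_upair, r_sub; FO_tac.


(** * Clubs as closure under a partial function *)

Section Clubs.
Variable M : universe.
Implicit Types x y z a b c p A B C P R S U W X Y Z : M.

(** On pair-closed sets, closure under functions of finitely many variables reduces to closure under
    one unary partial function, whose graph can be taken to be a subset of X. *)
Definition pair_closed X : Prop :=
  empty M ∈ X /\ forall x, x ∈ X -> forall y, y ∈ X -> opair x y ∈ X.

Fixpoint code (s : list M) : M :=
  match s with nil => empty M | x :: s' => opair x (code s') end.

Lemma code_inj s t : code s = code t -> s = t.
Proof.
revert t; induction s as [|x s IH]; intros [|y t]; cbn; intros E; auto.
- symmetry in E; destruct (opair_nonempty E).
- destruct (opair_nonempty E).
- apply opair_inj in E; destruct E as [-> E]; f_equal; auto.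
Qed.

Lemma code_mem X s : pair_closed X -> Forall (fun x => x ∈ X) s -> code s ∈ X.
Proof. intros [H0 H2]; induction 1; cbn; auto. Qed.

(** Cutting down to X keeps the relation in every V_delta that contains X, and loses no pair of
    elements of X when X is pair-closed. *)
Definition setrel X (Q : M -> M -> Prop) : M :=
  sep X (fun z => exists x y, Q x y /\ z = opair x y).

Lemma in_setrel X (Q : M -> M -> Prop) x y :
  opair x y ∈ setrel X Q <-> opair x y ∈ X /\ Q x y.
Proof.
unfold setrel; rewrite in_sep; split; intros [H1 H2]; split; auto.
- destruct H2 as [x' [y' [H E]]]; apply opair_inj in E; destruct E as [-> ->]; auto.
- exists x, y; auto.
Qed.

Lemma setrel_sub X (Q : M -> M -> Prop) : setrel X Q ⊆ X.
Proof. intros z Hz; apply in_sep in Hz; tauto. Qed.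

Lemma setrel_func X (Q : M -> M -> Prop) :
  (forall x y y', Q x y -> Q x y' -> y = y') -> (forall x y, Q x y -> y ∈ X) ->
  func (setrel X Q) X.
Proof.
intros H1 H2 x Hx y y' Hy Hy'; apply in_setrel in Hy, Hy'; split; [|eapply H2]; intuition eauto.
Qed.

(** This is the diagonal intersection of clubs: R' sends [opair i x] to the value of [R i] at x, and
    a pair-closed a containing i and x contains that pair. *)
Lemma func_diagonal X (R : M -> M) : pair_closed X -> (forall i, i ∈ X -> func (R i) X) ->
  exists R', R' ⊆ X /\ func R' X /\
    forall a, a ⊆ X -> pair_closed a -> closed R' a -> forall i, i ∈ a -> closed (R i) a.
Proof.
intros HX HR.
set (Q := fun p y => exists i x, i ∈ X /\ x ∈ X /\ opair x y ∈ R i /\ p = opair i x).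
exists (setrel X Q); split; [apply setrel_sub|split].
- apply setrel_func.
  + intros p y y' [i [x [Hi [Hx [Hy ->]]]]] [i' [x' [_ [_ [Hy' E]]]]].
    apply opair_inj in E; destruct E as [<- <-]; apply (HR i Hi x Hx y y'); auto.
  + intros p y [i [x [Hi [Hx [Hy _]]]]]; apply (HR i Hi x Hx y y); auto.
- intros a Ha Hp Hc i Hi x y Hx Hy.
  assert (HyX : y ∈ X) by (apply (HR i (Ha _ Hi) x (Ha _ Hx) y y); auto).
  apply (Hc (opair i x)); [apply Hp; auto|].
  apply in_setrel; split; [|exists i, x; auto].
  apply HX; auto; apply HX; auto.
Qed.

Lemma func_combine X R1 R2 : pair_closed X -> func R1 X -> func R2 X ->
  exists R, R ⊆ X /\ func R X /\
    forall a, a ⊆ X -> pair_closed a -> closed R a -> closed R1 a /\ closed R2 a.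
Proof.
intros HX H1 H2.
(* Two indices present in every pair-closed set are the empty set and the pair of it with itself. *)
set (R := fun i => if excluded_middle_informative (i = empty M) then R1 else R2).
destruct (@func_diagonal X R) as [R' [H3 [H4 H5]]]; auto.
- intros i _; unfold R; destruct excluded_middle_informative; auto.
- exists R'; split; [|split]; auto; intros a Ha Hp Hc; split.
  + assert (E := H5 a Ha Hp Hc (empty M) (proj1 Hp)); unfold R in E.
    destruct excluded_middle_informative; tauto.
  + assert (E := H5 a Ha Hp Hc (opair (empty M) (empty M))
      (proj2 Hp _ (proj1 Hp) _ (proj1 Hp))); unfold R in E.
    destruct excluded_middle_informative as [e|]; auto; destruct (opair_nonempty e).
Qed.

(** A unary function has no constants of its own, so e n is made the value at the code of n empty
    sets, an argument that every pair-closed set contains. *)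
Lemma func_constants X (e : nat -> M) : pair_closed X -> (forall n, e n ∈ X) ->
  exists R, R ⊆ X /\ func R X /\ forall a, pair_closed a -> closed R a -> forall n, e n ∈ a.
Proof.
intros HX He.
set (k := fun n => code (repeat (empty M) n)).
assert (Hk : forall a n, pair_closed a -> k n ∈ a).
- intros a n Ha; apply code_mem; auto; apply Forall_forall.
  intros x Hx; apply repeat_spec in Hx; subst; apply Ha.
- exists (setrel X (fun x y => exists n, x = k n /\ y = e n)).
  split; [apply setrel_sub|split].
  + apply setrel_func; [intros x y y' [n [-> ->]] [m [E ->]]|intros x y [n [-> ->]]; auto].
    apply code_inj, (f_equal (@length M)) in E; rewrite !repeat_length in E; subst; auto.
  + intros a Ha Hc n; apply (Hc (k n)); auto; apply in_setrel; split; eauto.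
    apply HX; auto.
Qed.

Lemma in_club_filter X A : A ∈ club_filter X <->
  A ⊆ pow X /\ exists Cs : list M, Forall (club X) Cs /\
    forall a, a ⊆ X -> Forall (fun C => a ∈ C) Cs -> a ∈ A.
Proof. apply in_powsep. Qed.

(** Each generating function f becomes the unary partial function sending [code s] to f s, and the
    finitely many of them are merged by [func_combine]. *)
Lemma club_filter_closed X A : pair_closed X -> A ∈ club_filter X ->
  exists R, R ⊆ X /\ func R X /\ forall a, a ⊆ X -> pair_closed a -> closed R a -> a ∈ A.
Proof.
intros HX HA; apply in_club_filter in HA; destruct HA as [_ [Cs [HC HA]]].
assert (E : exists R, R ⊆ X /\ func R X /\ forall a, a ⊆ X -> pair_closed a ->
  closed R a -> Forall (fun C => a ∈ C) Cs).
- clear HA A; induction HC as [|C Cs [f [Hf ->]] _ [R [H1 [H2 H3]]]].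
  + exists (empty M); split; [|split]; auto.
    * intros z Hz; destruct (in_empty Hz).
    * intros x _ y y' Hy; destruct (in_empty Hy).
  + set (Rf := setrel X (fun x y => exists s, Forall (fun x => x ∈ X) s /\
        x = code s /\ y = f s)).
    destruct (@func_combine X Rf R) as [R' [H4 [H5 H6]]]; auto.
    * apply setrel_func; [intros x y y' [s [_ [-> ->]]] [t [_ [E ->]]] |
                          intros x y [s [Hs [_ ->]]]; auto].
      apply code_inj in E; subst; auto.
    * exists R'; split; [|split]; auto; intros a Ha Hp Hc.
      destruct (H6 a Ha Hp Hc) as [H7 H8]; constructor; auto.
      apply in_powsep; split; auto; intros s Hs; apply (H7 (code s)).
      -- apply code_mem; auto.
      -- assert (Hs' : Forall (fun x => x ∈ X) s) by (eapply Forall_impl; [|exact Hs]; auto).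
         apply in_setrel; split; eauto; apply HX; auto; apply code_mem; auto.
- destruct E as [R [H1 [H2 H3]]]; exists R; split; [|split]; auto.
Qed.

Lemma closed_club_filter X R : pair_closed X -> func R X ->
  ⟦ a | a ⊆ X /\ pair_closed a /\ closed R a ⟧ ∈ club_filter X.
Proof.
intros HX HR; apply in_club_filter; split.
- intros a Ha; apply (@in_powsep M X (fun a => pair_closed a /\ closed R a)) in Ha.
  apply in_pow; tauto.
(* One function on finite sequences carries all three closure conditions, told apart by length:
   length zero gives the empty set, length one applies R, length two forms the pair. Outside the
   domain of R the argument itself is returned, which demands nothing. *)
- set (f := fun s : list M => match s with
    | x :: nil => match excluded_middle_informative (exists y, opair x y ∈ R) with
                  | left H => proj1_sig (constructive_indefinite_description _ H)
                  | right _ => x end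
    | x :: y :: nil => opair x y
    | _ => empty M end).
  exists (⟦ a | a ⊆ X /\ forall s, Forall (fun x => x ∈ a) s -> f s ∈ a ⟧ :: nil).
  split.
  + constructor; auto; exists f; split; auto.
    intros [|x [|y [|z s]]] Hs; cbn; try apply HX; inversion_clear Hs; auto.
    * destruct excluded_middle_informative as [e|]; auto.
      destruct constructive_indefinite_description as [y Hy]; cbn.
      apply (HR x H y y); auto.
    * inversion_clear H0; auto.
  + intros a Ha HC; inversion_clear HC as [|? ? H _].
    apply in_powsep in H; destruct H as [_ H].
    apply (@in_powsep M X (fun a => pair_closed a /\ closed R a)).
    split; auto; split; [split|].
    * apply (H nil); auto.
    * intros x Hx y Hy; apply (H (x :: y :: nil)); auto.
    * intros x y Hx Hy; assert (E : f (x :: nil) ∈ a) by auto; cbn in E.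
      destruct excluded_middle_informative as [e|n]; [|destruct n; eauto].
      destruct constructive_indefinite_description as [y' Hy']; cbn in E.
      destruct (HR x (Ha _ Hx) y y' Hy Hy') as [-> _]; auto.
Qed.

(** * The stationary sets of the tower *)

Lemma in_positive Z (G : M) U :
  U ∈ positive Z G <-> U ⊆ pow Z /\ ~ diff (pow Z) U ∈ G.
Proof.
unfold positive; rewrite in_diff, in_pow; unfold dual_ideal.
rewrite in_setof; [tauto|].
apply is_set_sub with (pow (pow Z)); intros A [HA _]; apply in_pow; auto.
Qed.

(** By fineness: if x were in no member of U, the measure one set of all a containing x would be
    disjoint from U. Hence a condition determines the set at which it is positive, and its support
    can be mentioned without [F]. *)
Lemma positive_bigcup Z (G : M) U : normal_filter Z G -> U ∈ positive Z G -> bigcup U = Z.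
Proof.
intros HG HU; apply in_positive in HU; destruct HU as [HU Hn].
apply sub_antisym; intros x Hx.
- apply in_bigcup in Hx; destruct Hx as [u [Hu Hx]]; apply HU, in_pow in Hu; auto.
- apply NNPP; intros Hn'; apply Hn; apply (nf_up HG (nf_fine HG Hx)).
  + intros a Ha; apply in_powsep in Ha; apply in_diff; split; [apply in_pow; tauto|].
    intros HaU; apply Hn', in_bigcup; exists a; tauto.
  + intros a Ha; apply in_diff in Ha; tauto.
Qed.

Lemma in_restrict X (G : M) S B :
  B ∈ restrict X G S <-> B ⊆ pow X /\ exists A, A ∈ G /\ cap A S ⊆ B.
Proof. apply in_powsep. Qed.

Lemma in_projection Y (G : M) A : A ∈ G ->
  ⟦ b | exists a, a ∈ A /\ b = cap a Y ⟧ ∈ projection Y G.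
Proof.
intros HA; unfold projection; rewrite in_setof; [eauto|].
destruct (is_set_image G (fun A => ⟦ b | exists a, a ∈ A /\ b = cap a Y ⟧)) as [w Hw].
exists w; exact Hw.
Qed.

(* Where W = V_delta, this describes the set S of F X = C_X|S in terms of the
   conditions alone, with quantifiers bounded by W, P, X and S. *)
Definition guides W P X S : Prop :=
  (forall a, a ∈ S -> a ⊆ X /\ pair_closed a) /\
  (forall U, U ∈ P -> bigcup U ⊆ X -> forall R, R ∈ W -> func R X ->
     exists a, a ∈ S /\ closed R a /\ trace U a) /\
  (forall B, B ∈ W -> B ⊆ S ->
     (forall R, R ∈ W -> func R X -> exists a, a ∈ B /\ closed R a) -> B ∈ P).

Variables (delta P : M) (F : M -> M).
Hypothesis P_tower : tower delta P F.
Hypothesis F_club : forall X : M, X ∈ Vrank delta ->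
  exists S : M, stationary X S /\ F X = restrict X (club_filter X) S.

Lemma in_P S : S ∈ P <->
  S ∈ Vrank delta /\ exists X, X ∈ Vrank delta /\ S ∈ positive X (F X).
Proof.
rewrite (tower_conditions P_tower), in_setof; [tauto|].
apply is_set_sub with (Vrank delta); tauto.
Qed.


(** The witness is the stationary set of F X cut down to pair-closed sets. If no closed a in it
    traced into U, then U would be disjoint from the projection of a set of F X, which by the tower
    property lies in the filter at the support of U, against positivity. If the complement of B were
    in F X, it would contain all elements of the stationary set that are closed under some R, but B
    has such an element. *)
Lemma guides_exists X : X ∈ Vrank delta -> pair_closed X ->
  exists S, S ∈ Vrank delta /\ guides (Vrank delta) P X S.
Proof.
intros HXV HX; assert (Hlim := tower_limit P_tower).
destruct (F_club HXV) as [S0 [_ HF]].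
assert (E : forall a, a ∈ ⟦ a | a ⊆ X /\ a ∈ S0 /\ pair_closed a ⟧ <->
  a ⊆ X /\ a ∈ S0 /\ pair_closed a)
  by (intros a; apply (@in_powsep M X (fun a => a ∈ S0 /\ pair_closed a))).
exists ⟦ a | a ⊆ X /\ a ∈ S0 /\ pair_closed a ⟧; split; [|split; [|split]].
- apply (Vrank_sub_closed (Vrank_pow Hlim HXV)).
  intros a Ha; apply E in Ha; apply in_pow; tauto.
- intros a Ha; apply E in Ha; tauto.
- intros U HU HUX R _ HR; apply in_P in HU; destruct HU as [_ [Z [HZV HU]]].
  assert (HZ := tower_normal P_tower HZV).
  assert (EU := positive_bigcup HZ HU); rewrite EU in HUX.
  apply NNPP; intros Hn; apply in_positive in HU; destruct HU as [_ HU]; apply HU.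
  set (A := ⟦ a | a ⊆ X /\ pair_closed a /\ closed R a ⟧).
  assert (EA : forall a, a ∈ A <-> a ⊆ X /\ pair_closed a /\ closed R a)
    by (intros a; apply (@in_powsep M X (fun a => pair_closed a /\ closed R a))).
  assert (HA : cap A S0 ∈ F X).
  + rewrite HF; apply in_restrict; split.
    * intros a Ha; apply in_cap in Ha; destruct Ha as [Ha _]; apply EA in Ha.
      apply in_pow; tauto.
    * exists A; split; [apply closed_club_filter; auto | intros z; auto].
  + apply (in_projection Z) in HA; rewrite (tower_project P_tower HZV HXV HUX) in HA.
    apply (nf_up HZ HA); [|intros b Hb; apply in_diff in Hb; tauto].
    assert (Es : is_set (fun b => exists a, a ∈ cap A S0 /\ b = cap a Z))
      by apply is_set_image.
    intros b Hb; rewrite in_setof in Hb by exact Es.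
    destruct Hb as [a [Ha ->]]; apply in_cap in Ha; destruct Ha as [Ha Ha0].
    apply EA in Ha; apply in_diff; split.
    * apply in_pow; intros z Hz; apply in_cap in Hz; tauto.
    * intros HaU; apply Hn; exists a; split; [apply E; tauto|split; [tauto|]].
      unfold trace; rewrite EU; auto.
- intros B HBV HB H; apply in_P; split; auto; exists X; split; auto.
  apply in_positive; split.
  + intros a Ha; apply HB, E in Ha; apply in_pow; tauto.
  + rewrite HF, in_restrict; intros [_ [A [HA HAS]]].
    destruct (club_filter_closed HX HA) as [R [HR1 [HR2 HR3]]].
    destruct (H R (Vrank_sub_closed HXV HR1) HR2) as [a [Ha Hc]].
    assert (Ha' := HB _ Ha); apply E in Ha'.
    assert (Had : a ∈ diff (pow X) B) by (apply HAS, in_cap; split; [apply HR3|]; tauto).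
    apply in_diff in Had; tauto.
Qed.

End Clubs.

(** * Absoluteness of the description of the stationary sets *)

Section Relativization.
Variables (M : universe) (D : M -> Prop).
Hypothesis D_trans : class_transitive D.
Implicit Types x y z a b c p A B C P R S T U W X Y Z E : M.

Definition r_pair_closed a : Prop :=
  (exists o, D o /\ o ∈ a /\ forall z, D z -> ~ z ∈ o) /\
  forall x, D x -> x ∈ a -> forall y, D y -> y ∈ a -> exists p, D p /\ p ∈ a /\ r_pair D p x y.

Definition r_guides W P X S : Prop :=
  (forall a, D a -> a ∈ S -> r_sub D a X /\ r_pair_closed a) /\
  (forall U, D U -> U ∈ P -> (forall s, D s -> s ∈ U -> r_sub D s X) ->
     forall R, D R -> R ∈ W -> r_func D R X ->
     exists a, D a /\ a ∈ S /\ r_closed D R a /\ r_trace D U a) /\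
  (forall B, D B -> B ∈ W -> r_sub D B S ->
     (forall R, D R -> R ∈ W -> r_func D R X -> exists a, D a /\ a ∈ B /\ r_closed D R a) ->
     B ∈ P).

Lemma abs_pair_closed a : D a -> r_pair_closed a <-> pair_closed a.
Proof.
intros Da; split.
- intros [[o [Do [Ho Hz]]] H]; split.
  + replace (empty M) with o; auto; apply extensionality; intros z; split.
    * intros Hzo; destruct (Hz z (D_trans Do Hzo) Hzo).
    * intros Hzo; destruct (in_empty Hzo).
  + intros x Hx y Hy; assert (Dx := D_trans Da Hx); assert (Dy := D_trans Da Hy).
    destruct (H x Dx Hx y Dy Hy) as [p [Dp [Hp E]]]; apply abs_pair in E; subst; auto.
- intros [H0 H]; split.
  + exists (empty M); split; [apply (D_trans Da H0)|split; auto].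
    intros z _; apply in_empty.
  + intros x Dx Hx y Dy Hy; assert (Hp := H x Hx y Hy); assert (Dp := D_trans Da Hp).
    exists (opair x y); split; [|split]; auto; apply abs_pair; auto.
Qed.

Lemma abs_guides W P X S : D W -> D P -> D X -> D S -> r_guides W P X S <-> guides W P X S.
Proof.
intros DW DP DX DS; unfold r_guides, guides; split; intros [H1 [H2 H3]]; (split; [|split]).
- intros a Ha; assert (Da := D_trans DS Ha); destruct (H1 a Da Ha) as [H4 H5].
  apply abs_sub in H4; auto; apply abs_pair_closed in H5; auto.
- intros U HU HUX R HR Hf; assert (DU := D_trans DP HU); assert (DR := D_trans DW HR).
  destruct (H2 U DU HU) with (R := R) as [a [Da [Ha [H4 H5]]]]; auto.
  + intros s Ds Hs z _ Hz; apply HUX, in_bigcup; eauto.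
  + apply abs_func; auto.
  + apply abs_closed in H4; auto; apply abs_trace in H5; eauto.
- intros B HB HBS H; assert (DB := D_trans DW HB); apply H3; auto; [apply abs_sub; auto|].
  intros R DR HR Hf; apply abs_func in Hf; auto; destruct (H R HR Hf) as [a [Ha Hc]].
  exists a; split; [apply (D_trans DB Ha)|split; auto]; apply abs_closed; auto.
- intros a Da Ha; destruct (H1 a Ha) as [H4 H5].
  split; [apply abs_sub | apply abs_pair_closed]; auto.
- intros U DU HU HUX R DR HR Hf; apply abs_func in Hf; auto.
  destruct (H2 U HU) with (R := R) as [a [Ha [H4 H5]]]; auto.
  + intros z Hz; apply in_bigcup in Hz; destruct Hz as [s [Hs Hz]].
    assert (Ds := D_trans DU Hs); apply (HUX s Ds Hs z (D_trans Ds Hz) Hz).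
  + assert (Da := D_trans DS Ha); exists a; split; [|split; [|split]]; auto;
      [apply abs_closed | apply abs_trace]; auto.
- intros B DB HB HBS H; apply H3; auto; [apply abs_sub in HBS; auto|].
  intros R HR Hf; assert (DR := D_trans DW HR).
  destruct (H R DR HR) as [a [Da [Ha Hc]]]; [apply abs_func; auto|].
  exists a; split; auto; apply abs_closed in Hc; auto.
Qed.

End Relativization.

(** * The supercompactness embedding *)

Section Embedding.
Variable M : universe.
Implicit Types x y z a b c p A B C R S U X Y Z : M.
Variables (delta lam : M) (N : M -> Prop) (j : M -> M).
Hypothesis delta_limit : limit_ordinal delta.
Hypothesis lam_card : is_cardinality lam (Vrank (succ (succ (add_omega delta)))).
Hypothesis N_trans : class_transitive N.
Hypothesis j_elem : elementary_embedding N j.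
Hypothesis delta_crit : critical_point j delta.
Hypothesis lam_j : lam ∈ j delta.
Hypothesis N_closed : forall f, function_on f lam ->
  (forall alpha, alpha ∈ lam -> N (app f alpha)) -> N f.

Notation V := (fun _ : M => True).
Notation Vd := (Vrank delta).
Notation Vw := (Vrank (add_omega delta)).

Lemma V_trans : class_transitive V.
Proof. intros x y; auto. Qed.

Lemma Nj x : N (j x).
Proof. apply j_elem. Qed.
Hint Resolve V_trans N_trans Nj I : core.

(** Elementarity for statements instead of formulas. The parameters are listed in [l], and [e 0],
    [e 1], ... refer to its entries. *)
Lemma transfer (Q : (M -> Prop) -> (nat -> M) -> Prop) (l : list M) :
  FO Q -> Q V (env l) -> Q N (fun n => j (env l n)).
Proof.
intros [p Hp] H; apply Hp; apply (proj2 j_elem); apply Hp; exact H.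
Qed.

Lemma j_mem x y : x ∈ y -> j x ∈ j y.
Proof.
exact (@transfer (fun D e => e 0 ∈ e 1) (x :: y :: nil) ltac:(FO_solve)).
Qed.

Lemma j_mem_iff x y : x ∈ y <-> j x ∈ j y.
Proof.
split; [apply j_mem|]; intros H; apply NNPP; intros Hn.
exact (@transfer (fun D e => ~ e 0 ∈ e 1) (x :: y :: nil) ltac:(FO_solve) Hn H).
Qed.

Lemma j_sub x y : x ⊆ y -> j x ⊆ j y.
Proof.
intros H; apply (@abs_sub M N); auto.
apply (@transfer (fun D e => r_sub D (e 0) (e 1)) (x :: y :: nil)); [FO_solve|].
apply abs_sub; auto.
Qed.

Lemma j_opair x y : j (opair x y) = opair (j x) (j y).
Proof.
apply (@abs_pair M N); auto.
apply (@transfer (fun D e => r_pair D (e 0) (e 1) (e 2)) (opair x y :: x :: y :: nil));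
  [FO_solve|].
apply abs_pair; auto.
Qed.

Lemma j_func R X : func R X -> func (j R) (j X).
Proof.
intros H; apply (@abs_func M N); auto.
apply (@transfer (fun D e => r_func D (e 0) (e 1)) (R :: X :: nil)); [FO_solve|].
apply abs_func; auto.
Qed.

Lemma j_trans x : transitive x -> transitive (j x).
Proof.
intros H y Hy z Hz.
assert (E := @transfer (fun D e => forall y, D y -> y ∈ e 0 -> forall z, D z -> z ∈ y -> z ∈ e 0)
  (x :: nil) ltac:(FO_solve)); cbn in E.
apply (E (fun y _ Hy z _ Hz => H y Hy z Hz) y (N_trans (Nj x) Hy) Hy z); auto.
apply (N_trans (N_trans (Nj x) Hy) Hz).
Qed.

Lemma j_pair_closed x : pair_closed x -> pair_closed (j x).
Proof.
intros H; apply (@abs_pair_closed M N); auto.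
apply (@transfer (fun D e => r_pair_closed D (e 0)) (x :: nil));
  [unfold r_pair_closed; FO_solve|].
apply abs_pair_closed; auto.
Qed.

(** * Closure of the target model *)

Lemma N_opair x y : N x -> N y -> N (opair x y).
Proof.
intros Nx Ny.
assert (E := @transfer (fun D e => forall x, D x -> forall y, D y -> exists p, D p /\ r_pair D p x y)
  nil ltac:(FO_solve)); cbn in E.
destruct (E (fun x _ y _ => ex_intro _ (opair x y) (conj I
  (proj2 (@abs_pair M V V_trans (opair x y) x y I I I) eq_refl))) x Nx y Ny) as [p [Np Hp]].
apply (@abs_pair M N) in Hp; subst; auto.
Qed.

(** Closure under sequences puts the function itself into N; its range follows because N satisfies
    the existence of ranges, by elementarity, and computes them correctly, by transitivity. *)
Lemma N_image (G : M -> M) : (forall alpha, alpha ∈ lam -> N (G alpha)) -> N (image lam G).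
Proof.
intros HG.
set (f := graph lam G).
assert (Nf : N f).
- apply N_closed; [apply graph_function|]; intros al Hal; unfold f; rewrite app_graph; auto.
- assert (E := @transfer (fun D e => forall f, D f -> exists r, D r /\ forall y, D y ->
    (y ∈ r <-> exists x, D x /\ r_mempair D f x y)) nil ltac:(FO_solve)); cbn in E.
  destruct E with (f := f) as [r [Nr Hr]]; auto.
  + intros g _.
    destruct (@is_set_sub M (fun y => exists x, True /\ r_mempair V g x y)
      (bigcup (bigcup g))) as [r Hr].
    * intros y [x [_ Hm]]; apply abs_mempair in Hm; auto.
      apply in_bigcup; exists (upair x y); split; [|apply in_upair; auto].
      apply in_bigcup; exists (opair x y); split; auto; apply in_upair; auto.
    * exists r; split; auto.
  + replace (image lam G) with r; auto; apply extensionality; intros y.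
    rewrite in_image; split.
    * intros Hy; assert (Ny := N_trans Nr Hy); apply Hr in Hy; auto.
      destruct Hy as [x [Nx Hm]]; apply (@abs_mempair M N) in Hm; auto.
      apply in_graph in Hm; destruct Hm as [Hx ->]; eauto.
    * intros [x [Hx ->]]; apply Hr; auto.
      assert (Hp : opair x (G x) ∈ f) by (apply in_graph; auto).
      destruct (D_opair N_trans (N_trans Nf Hp)) as [Nx _].
      exists x; split; auto; apply (@abs_mempair M N); auto.
Qed.

Lemma N_empty : N (empty M).
Proof.
assert (E : forall x, N x -> N (empty M)); [|apply (E (j (empty M))); auto].
apply (mem_ind (Q := fun x => N x -> N (empty M))); intros x IH Nx.
destruct (classic (exists y, y ∈ x)) as [[y Hy]|Hn].
- apply (IH y Hy (N_trans Nx Hy)).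
- replace (empty M) with x; auto; apply extensionality; intros z; split.
  + intros Hz; destruct Hn; eauto.
  + intros Hz; destruct (in_empty Hz).
Qed.

Lemma lam_enum : exists h : M -> M,
  (forall al, al ∈ lam -> h al ∈ Vrank (succ (succ (add_omega delta)))) /\
  forall y, y ∈ Vrank (succ (succ (add_omega delta))) -> exists al, al ∈ lam /\ h al = y.
Proof.
destruct lam_card as [_ [[f [Hf [H1 H2]]] _]]; exists (app f); split; auto.
intros y Hy; destruct (H2 y Hy) as [al [H _]]; eauto.
Qed.

Lemma N_enum (G : M -> M) y :
  y ⊆ Vrank (succ (succ (add_omega delta))) -> (forall z, z ∈ y -> N (G z)) -> N (image y G).
Proof.
intros Hy HN; destruct lam_enum as [h [_ Hh]].
destruct (classic (exists z, z ∈ y)) as [[z0 Hz0]|Hn].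
- replace (image y G) with
    (* [lam] enumerates all of V_(delta+omega+2); indices of points outside y are sent to the value
       at a fixed z0 in y. *)
    (image lam (fun al => if excluded_middle_informative (h al ∈ y) then G (h al) else G z0)).
  + apply N_image; intros al _; destruct excluded_middle_informative; auto.
  + apply extensionality; intros z; rewrite !in_image; split.
    * intros [al [_ ->]]; destruct excluded_middle_informative; eauto.
    * intros [u [Hu ->]]; destruct (Hh u (Hy u Hu)) as [al [Hal <-]].
      exists al; split; auto; destruct excluded_middle_informative; tauto.
- replace (image y G) with (empty M); [apply N_empty|].
  apply extensionality; intros z; rewrite in_image; split.
  + intros Hz; destruct (in_empty Hz).
  + intros [u [Hu _]]; destruct Hn; eauto.
Qed.

Let d_ord : ordinal delta := proj1 delta_limit.
Let w_limit : limit_ordinal (add_omega delta) := add_omega_limit d_ord.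
Let w_ord : ordinal (add_omega delta) := proj1 w_limit.

(** Membership induction gives the elements of V_(delta+omega+2) first: each is the image of itself
    under the identity, whose values are already known to lie in N. *)
Lemma N_sub y :
  y ⊆ Vrank (succ (succ (add_omega delta))) -> N y.
Proof.
assert (E : forall z, z ∈ Vrank (succ (succ (add_omega delta))) -> N z).
- apply (mem_ind (Q := fun z => z ∈ Vrank (succ (succ (add_omega delta))) -> N z)).
  intros z IH Hz; replace z with (image z (fun u => u)).
  + assert (Ht : z ⊆ Vrank (succ (succ (add_omega delta)))).
    * apply (Vrank_trans (proj1 (ordinal_succ (ordinal_succ w_ord)))); auto.
    * apply N_enum; auto.
  + apply extensionality; intros u; rewrite in_image; split; eauto.
    intros [? [? ->]]; auto.
- intros Hy; replace y with (image y (fun u => u)).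
  + apply N_enum; auto.
  + apply extensionality; intros u; rewrite in_image; split; eauto.
    intros [? [? ->]]; auto.
Qed.

Lemma Vw_sub : Vw ⊆ Vrank (succ (succ (add_omega delta))).
Proof. apply Vrank_mono; intros z Hz; apply in_succ; left; apply in_succ; auto. Qed.

Lemma pow_Vw_sub : pow Vw ⊆ Vrank (succ (succ (add_omega delta))).
Proof.
intros z Hz; apply in_pow in Hz; apply Vrank_succ; intros u Hu.
apply Vrank_succ; intros v Hv; apply (Vrank_trans (proj1 w_ord) (Hz _ Hu)); auto.
Qed.

(* Otherwise lam would be a subset of V_(delta+omega), mapped onto its power set. *)
Lemma add_omega_j : add_omega delta ∈ j delta.
Proof.
assert (Hl : add_omega delta ∈ lam).
- destruct (ordinal_mem_or_sub w_ord (proj1 lam_card)) as [|Hs]; auto.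
  destruct lam_enum as [h [_ Hh]].
  set (c := sep lam (fun x => ~ x ∈ h x)).
  destruct (Hh c) as [al [Hal E]].
  + apply pow_Vw_sub, in_pow; intros x Hx; apply in_sep in Hx.
    apply ord_in_Vrank; apply Hs; tauto.
  + assert (F : al ∈ c <-> al ∈ lam /\ ~ al ∈ h al) by apply in_sep.
    rewrite E in F; tauto.
- apply (j_trans (proj1 d_ord) lam_j); auto.
Qed.

Lemma jd_sub : succ (add_omega delta) ⊆ j delta.
Proof.
intros z Hz; apply in_succ in Hz; destruct Hz as [Hz| ->]; [|apply add_omega_j].
apply (j_trans (proj1 d_ord) add_omega_j); auto.
Qed.

(** [Vrank] comes from an inductive predicate and not from a formula, so [j] is applied to its graph
    on delta. The image [j vs] is a hierarchy of length j(delta), governed by the recursion clause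
    [jvs_rec]. *)
Let vs := graph delta (@Vrank M).

Lemma jvs_total al : al ∈ j delta -> exists u, u ∈ j Vd /\ opair al u ∈ j vs.
Proof.
intros Hal.
assert (E := @transfer (fun D e => forall al, D al -> al ∈ e 0 ->
  exists u, D u /\ u ∈ e 1 /\ r_mempair D (e 2) al u)
  (delta :: Vd :: vs :: nil) ltac:(FO_solve)); cbn in E.
destruct E with (al := al) as [u [Nu [Hu Hm]]]; auto.
- intros b _ Hb; exists (Vrank b); split; [|split]; auto.
  + apply in_Vrank_sub; exists b; split; auto; intros z; auto.
  + apply abs_mempair; auto; apply in_graph; auto.
- apply (N_trans (Nj delta) Hal).
- exists u; split; auto; apply (@abs_mempair M N) in Hm; auto.
  apply (N_trans (Nj delta) Hal).
Qed.

Lemma jvs_rec al u y : al ∈ j delta -> opair al u ∈ j vs -> N y ->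
  (y ∈ u <-> exists g u', g ∈ al /\ opair g u' ∈ j vs /\ y ⊆ u').
Proof.
intros Hal Hu Ny.
assert (E := @transfer (fun D e => forall al, D al -> al ∈ e 0 ->
  forall u, D u -> r_mempair D (e 1) al u -> forall y, D y ->
  (y ∈ u <-> exists g, D g /\ exists u', D u' /\ g ∈ al /\ r_mempair D (e 1) g u' /\
     r_sub D y u'))
  (delta :: vs :: nil) ltac:(FO_solve)); cbn in E.
assert (Nal := N_trans (Nj delta) Hal).
destruct (D_opair N_trans (N_trans (Nj vs) Hu)) as [_ Nu].
rewrite E with (al := al); auto.
- split.
  + intros [g [Ng [u' [Nu' [H1 [H2 H3]]]]]]; exists g, u'; split; [|split]; auto.
    * apply (@abs_mempair M N) in H2; auto.
    * apply (@abs_sub M N) in H3; auto.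
  + intros [g [u' [H1 [H2 H3]]]].
    destruct (D_opair N_trans (N_trans (Nj vs) H2)) as [Ng Nu'].
    exists g; split; auto; exists u'; split; auto; split; [|split]; auto.
    * apply (@abs_mempair M N); auto.
    * apply (@abs_sub M N); auto.
- intros b _ Hb v _ Hv z _; apply abs_mempair in Hv; auto.
  apply in_graph in Hv; destruct Hv as [_ ->]; rewrite in_Vrank_sub; split.
  + intros [g [Hg Hz]]; exists g; split; auto; exists (Vrank g); split; auto.
    split; [|split]; auto; [|apply abs_sub; auto].
    apply abs_mempair; auto; apply in_graph; split; auto; apply (proj1 d_ord b); auto.
  + intros [g [_ [u' [_ [Hg [Hm Hz]]]]]]; apply abs_mempair in Hm; auto.
    apply in_graph in Hm; destruct Hm as [_ ->]; exists g; split; auto.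
    apply (@abs_sub M V) in Hz; auto.
- apply (@abs_mempair M N); auto.
Qed.

(** By [jvs_rec], the value at al consists of the y in N included in an earlier value; up to
    delta+omega every such y is in N by [N_sub], so nothing is lost in the induction. *)
Lemma jvs_Vrank al u : al ∈ succ (add_omega delta) -> opair al u ∈ j vs -> u = Vrank al.
Proof.
revert u; apply (mem_ind (Q := fun al => forall u, al ∈ succ (add_omega delta) ->
  opair al u ∈ j vs -> u = Vrank al)); clear al; intros al IH u Hal Hu.
assert (Ht : forall g, g ∈ al -> g ∈ succ (add_omega delta))
  by (intros g Hg; apply (proj1 (ordinal_succ w_ord) al); auto).
assert (Hj := jd_sub Hal); destruct (D_opair N_trans (N_trans (Nj vs) Hu)) as [_ Nu].
apply extensionality; intros y; split.
- intros Hy; assert (Ny := N_trans Nu Hy); apply (jvs_rec Hj Hu Ny) in Hy.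
  destruct Hy as [g [u' [Hg [Hu' Hy]]]]; rewrite (IH g Hg u' (Ht g Hg) Hu') in Hy.
  apply in_Vrank_sub; eauto.
- intros Hy; assert (Ny : N y).
  + apply N_sub; apply (Vrank_trans (proj1 (ordinal_succ (ordinal_succ w_ord)))).
    apply (@Vrank_mono M al); auto; intros z Hz; apply in_succ; auto.
  + apply (jvs_rec Hj Hu Ny); apply in_Vrank_sub in Hy; destruct Hy as [g [Hg Hy]].
    destruct (jvs_total (jd_sub (Ht g Hg))) as [u' [_ Hu']].
    exists g, u'; split; [|split]; auto; rewrite (IH g Hg u'); auto.
Qed.

(** This makes V_(delta+omega) one of the sets X to which the image in N of the hypothesis on the
    tower applies. *)
Lemma Vw_j : Vw ∈ j Vd.
Proof.
destruct (jvs_total add_omega_j) as [u [Hu Hm]].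
rewrite <- (jvs_Vrank (al := add_omega delta) (u := u)); auto; apply in_succ; auto.
Qed.

Lemma j_fix x : x ∈ Vd -> j x = x.
Proof.
assert (E : forall b, b ∈ delta -> forall x, x ∈ Vrank b -> j x = x).
- apply (mem_ind (Q := fun b => b ∈ delta -> forall x, x ∈ Vrank b -> j x = x)).
  clear x; intros b IH Hb x Hx; apply in_Vrank_sub in Hx; destruct Hx as [g [Hg Hx]].
  assert (Hgd : g ∈ delta) by (apply (proj1 d_ord b); auto).
  assert (Ej : j (Vrank g) = Vrank g).
  + apply jvs_Vrank.
    * apply in_succ; left; apply in_add_omega; exists 0; auto.
    * rewrite <- (proj1 (proj2 delta_crit) g Hgd) at 1; rewrite <- j_opair.
      apply j_mem, in_graph; auto.
  + apply extensionality; intros y; split.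
    * intros Hy; assert (Hy' := j_sub Hx Hy); rewrite Ej in Hy'.
      apply (IH g) in Hy'; auto; rewrite <- Hy' in Hy; apply j_mem_iff in Hy; auto.
    * intros Hy; rewrite <- (IH g Hg Hgd y); auto; apply j_mem; auto.
- intros Hx; apply (Vrank_bound delta_limit) in Hx; destruct Hx as [b [Hb Hx]]; eauto.
Qed.

Lemma Vd_sub_j : Vd ⊆ j Vd.
Proof. intros x Hx; rewrite <- (j_fix Hx); apply j_mem; auto. Qed.

Lemma Vd_sub_Vw : Vd ⊆ Vw.
Proof. apply Vrank_mono; intros z Hz; apply in_add_omega; exists 0; auto. Qed.

Lemma jVd_sub_jVw : j Vd ⊆ j Vw.
Proof. apply j_sub, Vd_sub_Vw. Qed.

Lemma jVd_subset x y : x ∈ j Vd -> y ⊆ x -> N y -> y ∈ j Vd.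
Proof.
intros Hx Hy Ny; assert (Nx := N_trans (Nj _) Hx).
assert (E := @transfer (fun D e => forall x, D x -> x ∈ e 0 -> forall y, D y ->
  r_sub D y x -> y ∈ e 0) (Vd :: nil) ltac:(FO_solve)); cbn in E.
apply E with (x := x); auto.
- intros u _ Hu v _ Hv; apply (@abs_sub M V) in Hv; auto; apply (Vrank_sub_closed Hu Hv).
- apply (@abs_sub M N); auto.
Qed.

Lemma limit_pair_closed a : limit_ordinal a -> pair_closed (Vrank a).
Proof.
intros Ha; split; [apply empty_in_Vrank; auto|]; intros; apply Vrank_opair; auto.
Qed.

Let omega := range (@num M).

(** Otherwise delta is omega, and by elementarity each element of j(omega) is empty or a successor;
    but the limit delta is an element of j(delta). *)
Lemma omega_delta : omega ∈ delta.
Proof.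
assert (Hs : omega ⊆ delta).
- intros z Hz; apply in_range in Hz; destruct Hz as [n ->].
  induction n as [|n IH]; [|apply delta_limit; auto].
  destruct (ordinal_mem_or_sub (a := num M 0) (b := delta)) as [H|H]; auto.
  + split; intros y Hy; destruct (in_empty Hy).
  + destruct (proj1 (proj2 delta_limit)) as [y Hy]; destruct (in_empty (H _ Hy)).
- assert (Ho : ordinal omega).
  + split.
    * intros y Hy z Hz; apply in_range in Hy; destruct Hy as [n ->]; apply in_range.
      induction n as [|n IH]; [destruct (in_empty Hz)|].
      apply in_succ in Hz; destruct Hz as [Hz| ->]; eauto.
    * intros y Hy; apply (proj2 d_ord); auto.
  + destruct (ordinal_mem_or_sub Ho d_ord) as [|H]; auto.
    assert (Ed : delta = omega) by (apply sub_antisym; auto); exfalso.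
    assert (E := @transfer (fun D e => forall x, D x -> x ∈ e 0 ->
      (forall z, D z -> ~ z ∈ x) \/
      exists y, D y /\ y ∈ x /\ forall z, D z -> z ∈ x -> z ∈ y \/ z = y)
      (omega :: nil) ltac:(FO_solve)); cbn in E.
    destruct E with (x := delta) as [H0|[y [_ [Hy H1]]]].
    * intros x _ Hx; apply in_range in Hx; destruct Hx as [[|n] ->].
      -- left; intros z _; apply in_empty.
      -- right; exists (num M n); split; auto; split; [apply in_succ; auto|].
         intros z _ Hz; apply in_succ in Hz; auto.
    * destruct delta_crit as [_ [_ Hj]]; apply (N_trans (Nj _) Hj).
    * rewrite <- Ed; apply delta_crit.
    * destruct (proj1 (proj2 delta_limit)) as [z Hz]; apply (H0 z); auto.
      apply (N_trans (N_trans (Nj delta) (proj2 (proj2 delta_crit))) Hz).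
    * assert (Hsy := proj2 (proj2 delta_limit) _ Hy).
      destruct (H1 (succ y)) as [K|K]; auto.
      -- apply (N_trans (N_trans (Nj delta) (proj2 (proj2 delta_crit))) Hsy).
      -- apply (mem_asym K), in_succ; auto.
      -- apply (mem_irrefl (x := y)); rewrite <- K at 2; apply in_succ; auto.
Qed.

(** The sequence is coded by a set of pairs g. Since [j] fixes omega and each of its elements, j(g)
    is indexed by the same numbers, with value j(e n) at n. *)
Lemma j_range (e : nat -> M) : j (range e) = range (fun n => j (e n)).
Proof.
assert (Eo : forall n, j (num M n) = num M n).
- intros n; apply j_fix, ord_in_Vrank, (proj1 d_ord omega omega_delta), in_range; eauto.
- assert (Ew : j omega = omega) by (apply j_fix, ord_in_Vrank, omega_delta).
  set (g := range (fun n => opair (num M n) (e n))).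
  assert (Hg : forall x y, opair x y ∈ g <-> exists n, x = num M n /\ y = e n).
  + intros x y; unfold g; rewrite in_range; split.
    * intros [n En]; apply opair_inj in En; eauto.
    * intros [n [-> ->]]; eauto.
  + assert (Hf : func (j g) (j (cup omega (range e)))).
    * apply j_func; intros x _ y y' Hy Hy'; apply Hg in Hy, Hy'.
      destruct Hy as [n [-> ->]], Hy' as [m [Enm ->]]; apply num_inj in Enm; subst m.
      split; auto; apply in_cup; right; apply in_range; eauto.
    * assert (E := @transfer (fun D e => forall y, D y -> y ∈ e 0 -> exists i, D i /\
        i ∈ e 1 /\ r_mempair D (e 2) i y) (range e :: omega :: g :: nil) ltac:(FO_solve)).
      cbn in E; apply extensionality; intros y; rewrite in_range; split.
      -- intros Hy; assert (Ny := N_trans (Nj _) Hy).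
         destruct E with (y := y) as [i [Ni [Hi Hm]]]; auto.
         ++ intros z _ Hz; apply in_range in Hz; destruct Hz as [n ->].
            exists (num M n); split; auto; split; [apply in_range; eauto|].
            apply abs_mempair; auto; apply Hg; eauto.
         ++ apply (@abs_mempair M N) in Hm; auto.
            assert (Hi' := Hi); rewrite Ew in Hi'; apply in_range in Hi'.
            destruct Hi' as [n ->]; exists n.
            apply (Hf (num M n) (j_sub (fun z Hz => proj2 (in_cup _ _ z) (or_introl Hz)) Hi)); auto.
            rewrite <- (Eo n) at 1; rewrite <- j_opair; apply j_mem, Hg; eauto.
      -- intros [n ->]; apply j_mem, in_range; eauto.
Qed.

(** The restriction of [j] to V_(delta+omega), which N contains. In N it is a partial function on
    j(V_(delta+omega)), so elements of a stationary set there can be required to be closed under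
    it. *)
Definition j_graph : M := graph Vw j.

Lemma N_j_graph : N j_graph.
Proof.
apply N_enum; [apply Vw_sub|]; intros z Hz; apply N_opair; auto.
apply (N_trans (x := Vw)); auto; apply (N_trans (Nj Vd) Vw_j).
Qed.

Lemma j_graph_func : func j_graph (j Vw).
Proof.
intros x _ y y' Hy Hy'; apply in_graph in Hy, Hy'.
destruct Hy as [Hx ->], Hy' as [_ ->]; split; auto; apply j_mem; auto.
Qed.

(** * Extending elements of a stationary set *)

Variables (P : M) (F : M -> M).
Hypothesis P_tower : tower delta P F.
Hypothesis F_club : forall X : M, X ∈ Vrank delta ->
  exists S : M, stationary X S /\ F X = restrict X (club_filter X) S.

Lemma P_sub_Vd U : U ∈ P -> U ∈ Vd.
Proof. intros HU; apply (in_P P_tower) in HU; tauto. Qed.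

Lemma P_bigcup U : U ∈ P -> bigcup U ∈ Vd.
Proof. intros HU; apply Vrank_bigcup; auto; apply P_sub_Vd; auto. Qed.

Lemma P_sub_jP : P ⊆ j P.
Proof. intros U HU; rewrite <- (j_fix (P_sub_Vd HU)); apply j_mem; auto. Qed.

Let Vw_pair_closed : pair_closed Vw := limit_pair_closed w_limit.

Lemma guides_Vw : exists S, S ∈ j Vd /\ guides (j Vd) (j P) Vw S.
Proof.
assert (E := @transfer (fun D e => forall X, D X -> X ∈ e 0 -> r_pair_closed D X ->
  exists S, D S /\ S ∈ e 0 /\ r_guides D (e 0) (e 1) X S) (Vd :: P :: nil)
  ltac:(unfold r_guides, r_pair_closed; FO_solve)); cbn in E.
assert (NX : N Vw) by (apply (N_trans (Nj Vd) Vw_j)).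
destruct E with (X := Vw) as [S [NS [HS HG]]]; auto.
- intros X _ HX Hp; apply (abs_pair_closed V_trans) in Hp; auto.
  destruct (guides_exists P_tower F_club HX Hp) as [S [HS HG]].
  exists S; split; [|split]; auto; apply abs_guides; auto.
- apply Vw_j.
- apply abs_pair_closed; auto.
- exists S; split; auto; apply (@abs_guides M N) in HG; auto.
Qed.

Section Guided.
Variable S0 : M.
Hypothesis S0_j : S0 ∈ j Vd.
Hypothesis S0_guides : guides (j Vd) (j P) Vw S0.

Definition app_closed (a : M) : Prop :=
  forall g, g ∈ a -> forall x, x ∈ a -> app g x ∈ a.

Let St := sep S0 app_closed.

Lemma in_St a : a ∈ St -> a ∈ S0 /\ a ⊆ Vw /\ pair_closed a /\ app_closed a.
Proof.
intros Ha; apply in_sep in Ha; destruct Ha as [Ha Hc].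
destruct (proj1 S0_guides a Ha); auto.
Qed.

(** R, application and the constant y are merged into one function. It is a subset of
    V_(delta+omega), hence an element of j(V_delta), and U, being fixed by [j], is a condition of
    j(P) with support inside V_(delta+omega); so [guides] applies. *)
Lemma St_reflects U R y : U ∈ P -> func R Vw -> y ∈ Vw ->
  exists a, a ∈ St /\ y ∈ a /\ closed R a /\ trace U a.
Proof.
intros HU HR Hy.
destruct (@func_diagonal M Vw (fun g => setrel Vw (fun x z => z = app g x)))
  as [Ra [Ra1 [Ra2 Ra3]]]; auto.
- intros g Hg; apply setrel_func; [intros; congruence|].
  intros x z ->; apply (Vrank_app w_limit _ Hg).
- destruct (@func_constants M Vw (fun _ => y)) as [Rc [Rc1 [Rc2 Rc3]]]; auto.
  destruct (func_combine Vw_pair_closed HR Ra2) as [R1 [_ [R12 R13]]].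
  destruct (func_combine Vw_pair_closed R12 Rc2) as [R2 [R21 [R22 R23]]].
  destruct (proj1 (proj2 S0_guides) U) with (R := R2) as [a [Ha [Hc Ht]]]; auto.
  + apply P_sub_jP; auto.
  + intros z Hz; apply Vd_sub_Vw.
    apply (Vrank_trans (proj1 d_ord) (P_bigcup HU)); auto.
  + apply jVd_subset with Vw; auto; [apply Vw_j|].
    apply N_sub; intros z Hz; apply Vw_sub; auto.
  + destruct (proj1 S0_guides a Ha) as [HaX Hp].
    destruct (R23 a HaX Hp Hc) as [Hc1 Hcc]; destruct (R13 a HaX Hp Hc1) as [HcR Hca].
    exists a; split; [|split; [|split]]; auto.
    * apply in_sep; split; auto; intros g Hg x Hx.
      apply (Ra3 a HaX Hp Hca g Hg x); auto; apply in_setrel; split; auto.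
      apply Vw_pair_closed; auto; apply (Vrank_app w_limit); auto.
    * apply (Rc3 a Hp Hcc 0).
Qed.

Lemma jSt_reflects U R y : U ∈ j P -> N R -> func R (j Vw) -> y ∈ j Vw ->
  exists a, a ∈ j St /\ y ∈ a /\ closed R a /\ trace U a.
Proof.
intros HU NR HR Hy.
assert (E := @transfer (fun D e => forall U, D U -> U ∈ e 0 -> forall R, D R ->
  r_func D R (e 1) -> forall y, D y -> y ∈ e 1 ->
  exists a, D a /\ a ∈ e 2 /\ y ∈ a /\ r_closed D R a /\ r_trace D U a)
  (P :: Vw :: St :: nil) ltac:(FO_solve)); cbn in E.
assert (NU := N_trans (Nj P) HU).
destruct E with (U := U) (R := R) (y := y) as [a [Na [H1 [H2 [H3 H4]]]]]; auto.
- intros U' _ HU' R' _ HR' y' _ Hy'; apply (@abs_func M V) in HR'; auto.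
  destruct (St_reflects HU' HR' Hy') as [a [H1 [H2 [H3 H4]]]].
  exists a; split; [|split; [|split; [|split]]]; auto;
    [apply abs_closed | apply abs_trace]; auto.
- apply abs_func; auto.
- apply (N_trans (Nj _) Hy).
- exists a; split; [|split; [|split]]; auto.
  + apply (@abs_closed M N) in H3; auto.
  + apply (@abs_trace M N) in H4; auto.
Qed.

(* T is the set of pairs (code of a node, condition at that node), c is the code
   of the current node, and w is the trace on W of the element to be extended. *)
Definition extends Ss E W w c T : Prop :=
  exists a', a' ∈ Ss /\ E ⊆ a' /\ (forall z, z ∈ W -> (z ∈ a' <-> z ∈ w)) /\
    exists U T', opair U c ∈ a' /\ opair (opair U c) T' ∈ T /\ trace T' a'.

Definition r_extends (D : M -> Prop) Ss E W w c T : Prop :=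
  exists a', D a' /\ a' ∈ Ss /\ r_sub D E a' /\
    (forall z, D z -> z ∈ W -> (z ∈ a' <-> z ∈ w)) /\
    exists U, D U /\ exists T', D T' /\ exists x, D x /\ r_pair D x U c /\ x ∈ a' /\
      r_mempair D T x T' /\ r_trace D T' a'.

Lemma abs_extends (D : M -> Prop) Ss E W w c T : class_transitive D ->
  D Ss -> D E -> D W -> D c -> D T -> r_extends D Ss E W w c T <-> extends Ss E W w c T.
Proof.
intros Dt DS DE DW Dc DT; split.
- intros [a [Da [H1 [H2 [H3 [U [DU [T' [DT' [x [Dx [H4 [H5 [H6 H7]]]]]]]]]]]]]].
  apply abs_pair in H4; auto; subst x.
  exists a; split; [|split; [|split]]; auto.
  + apply abs_sub in H2; auto.
  + intros z Hz; apply H3; auto; apply (Dt _ _ DW Hz).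
  + exists U, T'; split; [|split]; auto;
      [apply abs_mempair in H6 | apply abs_trace in H7]; auto.
- intros [a [H1 [H2 [H3 [U [T' [H4 [H5 H6]]]]]]]].
  assert (Da := Dt _ _ DS H1); assert (Dx := Dt _ _ Da H4).
  destruct (D_opair Dt Dx) as [DU _]; destruct (D_opair Dt (Dt _ _ DT H5)) as [_ DT'].
  exists a; split; [|split; [|split; [|split]]]; auto; [apply abs_sub; auto|].
  exists U; split; auto; exists T'; split; auto; exists (opair U c).
  split; [|split; [|split; [|split]]]; auto;
    [apply abs_pair | apply abs_mempair | apply abs_trace]; auto.
Qed.

(** * The tree of plays *)

Variables (Node : Type) (cond : Node -> M) (next : Node -> M -> Node) (root : Node).
Hypothesis cond_P : forall nu, cond nu ∈ P.
Hypothesis cond_next : forall nu U, U ∈ P -> tower_le U (cond nu) ->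
  tower_le (cond (next nu U)) U.

(** The list records the moves, latest first. A move is an arbitrary condition below the current
    one, and [next] answers it with a node whose condition is below the move. *)
Fixpoint node (s : list M) : Node :=
  match s with nil => root | U :: s' => next (node s') U end.

Fixpoint chain (s : list M) : Prop :=
  match s with nil => True | U :: s' => chain s' /\ U ∈ P /\ tower_le U (cond (node s')) end.

Let Vd_pair_closed : pair_closed Vd := limit_pair_closed delta_limit.

Lemma chain_code s : chain s -> code s ∈ Vd.
Proof.
intros Hs; apply code_mem; auto; induction s as [|U s IH]; constructor.
- apply P_sub_Vd, Hs.
- apply IH, Hs.
Qed.

(** The tree in the form of a subset of V_delta, to which [j] can be applied although [Node] is a
    type of the metatheory. *)
Let table := setrel Vd (fun x y => exists U s, chain (U :: s) /\ x = code (U :: s) /\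
  y = cond (node (U :: s))).

Lemma in_table U s : chain (U :: s) -> opair (opair U (code s)) (cond (next (node s) U)) ∈ table.
Proof.
intros H; apply in_setrel; split; [|exists U, s; auto].
apply Vd_pair_closed; [apply (chain_code H)|apply P_sub_Vd, cond_P].
Qed.

Lemma table_chain U s T : opair (opair U (code s)) T ∈ table ->
  chain (U :: s) /\ T = cond (next (node s) U).
Proof.
intros H; apply in_setrel in H; destruct H as [_ [U' [s' [H [E ->]]]]].
cbn in E; apply opair_inj in E; destruct E as [-> E]; apply code_inj in E; subst; auto.
Qed.

(** Every legal move in [P] has its answer in [table], so by elementarity every condition of j(P)
    below [cond (node s)] has one in [j table]. That condition and [code s] lie in V_delta and are
    fixed by [j]. *)
Lemma j_next s B : chain s -> B ∈ j P -> tower_le B (cond (node s)) ->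
  exists T, T ∈ j P /\ tower_le T B /\ opair (opair B (code s)) T ∈ j table.
Proof.
intros Hs HB Hle.
assert (E := @transfer (fun D e => forall U, D U -> U ∈ e 0 -> r_le D U (e 1) ->
  exists T, D T /\ T ∈ e 0 /\ r_le D T U /\
    exists x, D x /\ r_pair D x U (e 2) /\ r_mempair D (e 3) x T)
  (P :: cond (node s) :: code s :: table :: nil) ltac:(FO_solve)); cbn in E.
rewrite (j_fix (chain_code Hs)), (j_fix (P_sub_Vd (cond_P (node s)))) in E.
assert (Nc : N (code s)) by (rewrite <- (j_fix (chain_code Hs)); auto).
assert (Nn : N (cond (node s))) by (rewrite <- (j_fix (P_sub_Vd (cond_P (node s)))); auto).
assert (NB := N_trans (Nj P) HB).
destruct E with (U := B) as [T [NT [HT [H1 [x [Nx [H2 H3]]]]]]]; auto.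
- intros U _ HU HUle; apply (@abs_le M V) in HUle; auto.
  exists (cond (next (node s) U)); split; [|split; [|split]]; auto.
  + apply abs_le; auto.
  + exists (opair U (code s)); split; [|split]; auto; [apply abs_pair; auto|].
    apply abs_mempair; auto; apply in_table; split; auto.
- apply abs_le; auto.
- apply (@abs_le M N) in H1; auto; apply (@abs_pair M N) in H2; auto.
  apply (@abs_mempair M N) in H3; auto; subst; eauto.
Qed.

(* If the set B of counterexamples were stationary, it would be a condition of
   j(P); an extension b of some a ∈ B below the next node of j(P) would then
   witness for j(a) what fails for a. *)
Lemma extension_almost_everywhere s : chain s ->
  exists R, func R Vw /\ forall a, a ∈ St -> closed R a -> trace (cond (node s)) a ->
    forall (e : nat -> M) W, (forall n, e n ∈ a) -> W ∈ Vd ->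
    extends St (range e) W (cap a W) (code s) table.
Proof.
intros Hs; apply NNPP; intros Hn.
set (B := sep St (fun a => trace (cond (node s)) a /\ exists (e : nat -> M) W,
  (forall n, e n ∈ a) /\ W ∈ Vd /\ ~ extends St (range e) W (cap a W) (code s) table)).
assert (HB : forall R, func R Vw -> exists a, a ∈ B /\ closed R a).
- intros R HR; apply NNPP; intros Hna; apply Hn; exists R; split; auto.
  intros a Ha Hc Ht e W He HW; apply NNPP; intros Hne; apply Hna; exists a; split; auto.
  apply in_sep; split; auto; split; auto; exists e, W; auto.
- assert (HBSt : B ⊆ St) by (intros a Ha; apply in_sep in Ha; tauto).
  assert (HBS : B ⊆ S0) by (intros a Ha; apply in_St; auto).
  assert (HBV : B ∈ j Vd).
  { apply jVd_subset with S0; auto; apply N_sub.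
    intros a Ha; apply pow_Vw_sub, in_pow, S0_guides; auto. }
  assert (HBP : B ∈ j P) by (apply S0_guides; auto).
  assert (EB : bigcup B = Vw).
  { apply sub_antisym; intros x Hx.
    - apply in_bigcup in Hx; destruct Hx as [a [Ha Hx]]; apply HBS in Ha.
      apply S0_guides in Ha; apply Ha; auto.
    - destruct (@func_constants M Vw (fun _ => x)) as [R [_ [H1 H2]]]; auto.
      destruct (HB R H1) as [a [Ha Hc]]; apply in_bigcup; exists a; split; auto.
      refine (H2 a _ Hc 0); apply S0_guides; auto. }
  assert (HBle : tower_le B (cond (node s))).
  { split.
    - rewrite EB; intros z Hz; apply Vd_sub_Vw.
      apply (Vrank_trans (proj1 d_ord) (P_bigcup (cond_P (node s)))); auto.
    - intros a Ha; apply in_sep in Ha; tauto. }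
  destruct (j_next Hs HBP HBle) as [T [HT [HTB Htab]]].
  assert (Hcode : code s ∈ j Vd) by (apply Vd_sub_j, chain_code; auto).
  (* T is the condition to be met, closure under [j_graph] puts j(x) into b for every x of b in
     V_(delta+omega), and the last request is the code of the history extended by the move B. *)
  destruct (@jSt_reflects T j_graph (opair B (code s))) as [b [Hb [Hxb [Hcb Htb]]]]; auto.
  { apply N_j_graph. }
  { apply j_graph_func. }
  { apply jVd_sub_jVw, j_pair_closed; auto. }
  (* The counterexample is read off from b: as b traces into T and T is below B, the part of b in
     V_(delta+omega) belongs to B. *)
  assert (Ha : cap b Vw ∈ B).
  { destruct HTB as [H1 H2]; apply H2 in Htb; rewrite EB in Htb, H1.
    replace (cap b Vw) with (cap (cap b (bigcup T)) Vw); auto.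
    apply extensionality; intros z; rewrite !in_cap; split; [tauto|].
    intros [Hz1 Hz2]; auto. }
  apply in_sep in Ha; destruct Ha as [_ [_ [e [W [He [HW Hne]]]]]].
  assert (E := @transfer (fun D e => ~ r_extends D (e 0) (e 1) (e 2) (e 3) (e 4) (e 5))
    (St :: range e :: W :: cap (cap b Vw) W :: code s :: table :: nil)
    ltac:(unfold r_extends; FO_solve)); cbn in E.
  (* W, its part in b and the code of s lie in V_delta and do not move, while the countable set is
     moved elementwise. The failure thus transfers to N with explicit parameters, and b refutes
     it. *)
  rewrite j_range, (j_fix HW), (j_fix (chain_code Hs)), (@j_fix (cap (cap b Vw) W)) in E.
  + apply E; [intros H; apply Hne; apply (@abs_extends V) in H; auto|].
    apply abs_extends; auto.
    * rewrite <- j_range; auto.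
    * rewrite <- (j_fix HW); auto.
    * rewrite <- (j_fix (chain_code Hs)); auto.
    * exists b; split; [|split; [|split]]; auto.
      -- intros z Hz; apply in_range in Hz; destruct Hz as [n ->].
         specialize (He n); apply in_cap in He; destruct He as [He1 He2].
         apply (Hcb (e n)); auto; apply in_graph; auto.
      -- intros z Hz; rewrite !in_cap; split; [|tauto]; intros Hzb; split; auto; split; auto.
         apply Vd_sub_Vw; apply (Vrank_trans (proj1 d_ord) HW); auto.
      -- exists B, T; auto.
  + apply (Vrank_sub_closed HW); intros z Hz; apply in_cap in Hz; tauto.
Qed.

(* The trick: a partial function on V_(delta+omega) is the union of countably
   many elements R_n of V_(delta+omega). As elements of St are closed under
   application, those containing all R_n are closed under the function. *)
Lemma extension_property : exists e : nat -> M, (forall n, e n ∈ Vw) /\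
  forall s a W, chain s -> a ∈ St -> (forall n, e n ∈ a) -> code s ∈ a ->
    trace (cond (node s)) a -> W ∈ Vd ->
    extends St (range e) W (cap a W) (code s) table.
Proof.
(* Chains are indexed by their codes, with the empty function at all other indices, so that one
   diagonal function serves every chain whose code is in a. *)
assert (C : forall i, exists R, func R Vw /\ forall s, chain s -> code s = i ->
  forall a, a ∈ St -> closed R a -> trace (cond (node s)) a ->
    forall (e : nat -> M) W, (forall n, e n ∈ a) -> W ∈ Vd ->
    extends St (range e) W (cap a W) (code s) table).
- intros i; destruct (classic (exists s, chain s /\ code s = i)) as [[s [Hs <-]]|Hn].
  + destruct (extension_almost_everywhere Hs) as [R [H1 H2]]; exists R; split; auto.
    intros s' Hs' E; apply code_inj in E; subst; auto.
  + exists (empty M); split.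
    * intros x _ y y' Hy; destruct (in_empty Hy).
    * intros s Hs E; destruct Hn; eauto.
- set (R := fun i => proj1_sig (constructive_indefinite_description _ (C i))).
  assert (HR := fun i => proj2_sig (constructive_indefinite_description _ (C i))).
  fold R in HR.
  destruct (@func_diagonal M Vw R) as [Q [Q1 [Q2 Q3]]]; auto; [intros i _; apply HR|].
  set (V_ := fun n => Vrank (Nat.iter n (@succ M) delta)).
  set (e := fun n => sep Q (fun z => exists x y, x ∈ V_ n /\ y ∈ V_ n /\ z = opair x y)).
  exists e; split.
  (* Pairs of elements of V_(delta+n) lie in V_(delta+n+2), so a set of them lies in
     V_(delta+n+3). *)
  + intros n; apply (Vrank_add_omega _ d_ord); exists (S (S (S n))).
    apply Vrank_succ; intros z Hz; apply in_sep in Hz.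
    destruct Hz as [_ [x [y [Hx [Hy ->]]]]]; apply opair_rank; auto.
  + intros s a W Hs Ha He Hc Ht HW.
    destruct (in_St Ha) as [_ [HaX [Hp Hap]]].
    refine (proj2 (HR (code s)) s Hs eq_refl a Ha _ Ht e W He HW).
    apply (Q3 a HaX Hp); auto.
    intros x y Hx Hxy; assert (Hy : y ∈ Vw) by (apply (Q2 x (HaX _ Hx) y y Hxy Hxy)).
    destruct (Vrank_bound2 w_limit (HaX _ Hx) Hy) as [b [Hb [H1 H2]]].
    apply in_add_omega in Hb; destruct Hb as [n Hn].
    assert (Hm : Vrank b ⊆ V_ n) by (apply Vrank_mono, (proj1 (ordinal_iter_succ n d_ord)); auto).
    replace y with (app (e n) x); [apply Hap; auto|].
    apply app_eq.
    * apply in_sep; split; auto; exists x, y; auto.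
    * intros y' Hy'; apply in_sep in Hy'; destruct Hy' as [Hy' _].
      apply (Q2 x (HaX _ Hx) y' y); auto.
Qed.

(** A stage of the construction: the current element of [St], the history of moves, and the set on
    which this element agrees with its predecessor. *)
Record state : Type := State {
  st_set : M; st_seq : list M; st_dom : M
}.

Lemma infinite_branch : exists (nu : nat -> Node) (U : nat -> M) (a : M), nu 0 = root /\
  forall n, U n ∈ P /\ tower_le (U n) (cond (nu n)) /\ nu (S n) = next (nu n) (U n) /\
    trace (cond (nu n)) a.
Proof.
destruct extension_property as [e [He Hext]].
set (good := fun p : state => st_set p ∈ St /\ (forall n, e n ∈ st_set p) /\
  chain (st_seq p) /\ code (st_seq p) ∈ st_set p /\
  trace (cond (node (st_seq p))) (st_set p) /\ st_dom p ∈ Vd).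
(* The next element must also agree on the support of the current condition, which settles the trace
   there for good. *)
set (dom := fun p : state => cup (st_dom p) (bigcup (cond (node (st_seq p))))).
set (step := fun p q : state => st_dom q = dom p /\
  (forall z, z ∈ dom p -> (z ∈ st_set q <-> z ∈ st_set p)) /\
  exists U, st_seq q = U :: st_seq p).
assert (Hstep : forall p : {p | good p}, {q : {p | good p} | step (proj1_sig p) (proj1_sig q)}).
{ intros [p [H1 [H2 [H3 [H4 [H5 H6]]]]]]; cbn; apply constructive_indefinite_description.
  assert (HD : dom p ∈ Vd) by (apply Vrank_cup; auto; apply P_bigcup, cond_P).
  destruct (Hext _ _ _ H3 H1 H2 H4 H5 HD) as [a [G1 [G2 [G3 [U [T [G4 [G5 G6]]]]]]]].
  apply table_chain in G5; destruct G5 as [G5 ->].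
  assert (HG : good (State a (U :: st_seq p) (dom p))).
  { split; [|split; [|split; [|split; [|split]]]]; auto.
    intros n; apply G2, in_range; eauto. }
  exists (exist _ _ HG); split; [|split]; cbn; eauto.
  intros z Hz; rewrite (G3 z Hz), in_cap; tauto. }
assert (Hstart : exists p : state, good p /\ st_seq p = nil).
{ destruct (@func_constants M Vw e) as [R [_ [R1 R2]]]; auto.
  destruct (@St_reflects (cond root) R (empty M)) as [a [H1 [_ [H2 H3]]]]; auto.
  { apply Vw_pair_closed. }
  destruct (in_St H1) as [_ [_ [Hp _]]].
  exists (State a nil (empty M)); split; auto; split; [|split; [|split; [|split; [|split]]]];
    cbn; auto.
  - apply Hp.
  - apply Vd_pair_closed. }
destruct Hstart as [p0 [Hp0 E0]].
set (q := fun n => Nat.iter n (fun r : {p : state | good p} => proj1_sig (Hstep r))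
  (exist good p0 Hp0)).
set (p := fun n => proj1_sig (q n)).
assert (Hp : forall n, good (p n)) by (intros n; apply (proj2_sig (q n))).
assert (Hs : forall n, step (p n) (p (S n))) by (intros n; apply (proj2_sig (Hstep (q n)))).
assert (HU : forall n, exists U, st_seq (p (S n)) = U :: st_seq (p n)) by (intros n; apply Hs).
set (U := fun n => proj1_sig (constructive_indefinite_description _ (HU n))).
assert (EU : forall n, st_seq (p (S n)) = U n :: st_seq (p n))
  by (intros n; apply (proj2_sig (constructive_indefinite_description _ (HU n)))).
assert (Hmono : forall n k, dom (p n) ⊆ dom (p (k + n))).
{ intros n k; induction k as [|k IH]; intros z Hz; cbn; auto.
  apply IH in Hz; unfold dom at 1; rewrite (proj1 (Hs (k + n))); apply in_cup; auto. }
assert (Hagree : forall n k z, z ∈ dom (p n) ->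
  (z ∈ st_set (p (k + n)) <-> z ∈ st_set (p n))).
{ intros n k z Hz; induction k as [|k IH]; cbn; [tauto|]; rewrite <- IH.
  apply (Hs (k + n)), Hmono; auto. }
(* The elements of [St] need not converge as sets; only their parts on [dom (p n)] are stable, and
   these are collected. *)
set (a := lim (fun n => cap (st_set (p n)) (dom (p n)))).
exists (fun n => node (st_seq (p n))), U, a; split.
{ unfold p, q; cbn; rewrite E0; auto. }
intros n; destruct (Hp (S n)) as [_ [_ [Hc _]]]; rewrite EU in Hc; cbn in Hc.
split; [|split; [|split]]; try tauto; [rewrite EU; auto|].
destruct (Hp n) as [_ [_ [_ [_ [Ht _]]]]]; unfold trace in *.
replace (cap a (bigcup (cond (node (st_seq (p n)))))) with
  (cap (st_set (p n)) (bigcup (cond (node (st_seq (p n)))))); auto.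
apply extensionality; intros z; rewrite !in_cap; unfold a; rewrite in_lim; split.
- intros [H1 H2]; split; auto; exists n; apply in_cap; split; auto; apply in_cup; auto.
- intros [[m Hm] Hz]; split; auto; apply in_cap in Hm; destruct Hm as [Hm1 Hm2].
  destruct (Compare_dec.le_ge_dec n m) as [L|L].
  + apply (Hagree n (m - n)); [apply in_cup; auto|].
    replace (m - n + n) with m by lia; auto.
  + replace n with (n - m + m) by lia; apply Hagree; auto.
Qed.

End Guided.

(** Precipitousness in game form: against any strategy [next] there is a play all of whose
    conditions are met by a single set a. *)
Lemma tower_branch (Node : Type) (cond : Node -> M) (next : Node -> M -> Node) (root : Node) :
  (forall nu, cond nu ∈ P) ->
  (forall nu U, U ∈ P -> tower_le U (cond nu) -> tower_le (cond (next nu U)) U) ->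
  exists (nu : nat -> Node) (U : nat -> M) (a : M), nu 0 = root /\
    forall n, U n ∈ P /\ tower_le (U n) (cond (nu n)) /\ nu (S n) = next (nu n) (U n) /\
      trace (cond (nu n)) a.
Proof.
intros H1 H2; destruct guides_Vw as [S0 [HS0 HG]].
apply (infinite_branch HS0 HG (cond := cond)); auto.
Qed.

End Embedding.

(** * Forcing *)

Section Forcing.
Variables (M : universe) (P : M) (le : M -> M -> Prop).
Hypothesis le_refl : forall p, le p p.
Hypothesis le_trans : forall p q r, le p q -> le q r -> le p r.
Implicit Types p q r s t u x y z : M.

(** In s, the name u of a pair [opair u r] sits three memberships deep, so the induction carries Q
    for x, its elements and their elements. *)
Lemma name_ind (Q : M -> Prop) :
  (forall s, (forall u r, opair u r ∈ s -> Q u) -> Q s) -> forall s, Q s.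
Proof.
intros H.
assert (E : forall x, Q x /\ forall y, y ∈ x -> Q y /\ forall z, z ∈ y -> Q z).
- apply mem_ind; intros x IH; split.
  + apply H; intros u r Hu; apply (proj2 (IH _ Hu) (upair u u)); apply in_upair; auto.
  + intros y Hy; split; [apply IH; auto|]; intros z Hz; apply (proj2 (IH y Hy)); auto.
- intros s; apply E.
Qed.

Lemma forces_eq_sym s t p : forces_eq P le s t p -> forces_eq P le t s p.
Proof. intros [H1 H2]; constructor; auto. Qed.

Lemma forces_eq_mono s t p q : forces_eq P le s t p -> le q p -> forces_eq P le s t q.
Proof. intros [H1 H2] Hq; constructor; eauto. Qed.

Lemma forces_mem_mono s t p q : forces_mem P le s t p -> le q p -> forces_mem P le s t q.
Proof. intros [H] Hq; constructor; eauto. Qed.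

Lemma forces_eq_refl s p : forces_eq P le s s p.
Proof.
revert p; apply (name_ind (Q := fun s => forall p, forces_eq P le s s p)).
clear s; intros s IH p.
assert (E : forall u r q, opair u r ∈ s -> q ∈ P -> le q p -> le q r -> forces_mem P le u s q).
- intros u r q Hu Hq _ Hqr; constructor; intros q' Hq' Hle.
  exists q'; split; [|split]; auto; exists u, r; split; [|split]; eauto.
- constructor; exact E.
Qed.

Lemma is_check_unique x c : is_check P x c -> forall c', is_check P x c' -> c = c'.
Proof.
revert c; apply (mem_ind (Q := fun x => forall c, is_check P x c ->
  forall c', is_check P x c' -> c = c')).
clear x; intros x IH.
assert (E : forall c c', is_check P x c -> is_check P x c' -> c ⊆ c').
- intros c c' [H1 _] [_ H2] z Hz; destruct (H1 z Hz) as [y [d [p [Hy [Hp [-> Hd]]]]]].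
  destruct (H2 y p Hy Hp) as [d' [Hd' Hc]]; rewrite (IH y Hy d Hd d' Hc); auto.
- intros c Hc c' Hc'; apply sub_antisym; auto.
Qed.

Lemma check_spec x : is_check P x (check P x).
Proof.
apply (mem_ind (Q := fun x => is_check P x (check P x))); clear x; intros x IH.
unfold check; apply epsilon_spec.
exists (bigcup (image x (fun y => image P (fun p => opair (check P y) p)))); constructor.
- intros z Hz; apply in_bigcup in Hz; destruct Hz as [w [Hw Hz]].
  apply in_image in Hw; destruct Hw as [y [Hy ->]].
  apply in_image in Hz; destruct Hz as [p [Hp ->]]; exists y, (check P y), p; auto.
- intros y p Hy Hp; exists (check P y); split; auto; apply in_bigcup.
  exists (image P (fun p => opair (check P y) p)); split; apply in_image; eauto.
Qed.

Lemma in_check x z : z ∈ check P x <-> exists y p, y ∈ x /\ p ∈ P /\ z = opair (check P y) p.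
Proof.
destruct (check_spec x) as [H1 H2]; split.
- intros Hz; destruct (H1 z Hz) as [y [d [p [Hy [Hp [-> Hd]]]]]]; exists y, p.
  rewrite (is_check_unique Hd (check_spec y)); auto.
- intros [y [p [Hy [Hp ->]]]]; destruct (H2 y p Hy Hp) as [d [Hd Hc]].
  rewrite (is_check_unique (check_spec y) Hc); auto.
Qed.

(** The name t links the two check names; a member u of it links z to some z' in the same way, so
    the link is passed on in the induction that proves x = y. *)
Lemma forces_check_elements x y t p z : p ∈ P ->
  forces_eq P le t (check P x) p -> forces_eq P le t (check P y) p -> z ∈ x ->
  exists z' u q, z' ∈ y /\ q ∈ P /\
    forces_eq P le u (check P z) q /\ forces_eq P le u (check P z') q.
Proof.
intros Hp [_ H1] [H2 _] Hz.
destruct (H1 (check P z) p p) as [H]; auto; [apply in_check; eauto|].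
destruct (H p) as [q [Hq [Hqp [u [r [Hu [Hqr Hqe]]]]]]]; auto.
destruct (H2 u r q) as [H']; auto.
destruct (H' q) as [q' [Hq' [Hqq [u' [r' [Hu' [_ Hqe']]]]]]]; auto.
apply in_check in Hu'; destruct Hu' as [z' [p' [Hz' [_ E]]]].
apply opair_inj in E; destruct E as [-> _].
exists z', u, q'; split; [|split; [|split]]; auto.
apply (forces_eq_mono (forces_eq_sym Hqe)); auto.
Qed.

Lemma forces_check_inj x y t p : p ∈ P ->
  forces_eq P le t (check P x) p -> forces_eq P le t (check P y) p -> x = y.
Proof.
revert y t p; apply (mem_ind (Q := fun x => forall y t p, p ∈ P ->
  forces_eq P le t (check P x) p -> forces_eq P le t (check P y) p -> x = y)).
clear x; intros x IH y t p Hp H1 H2; apply sub_antisym; intros z Hz.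
- destruct (forces_check_elements Hp H1 H2 Hz) as [z' [u [q [Hz' [Hq [E1 E2]]]]]].
  rewrite (IH z Hz z' u q); auto.
- destruct (forces_check_elements Hp H2 H1 Hz) as [z' [u [q [Hz' [Hq [E1 E2]]]]]].
  rewrite <- (IH z' Hz' z u q); auto.
Qed.

(** The witness in the generic name is some [check P r] with r above the extension q; as check names
    are injective, r is S. *)
Lemma forces_generic S p : p ∈ P -> forces_mem P le (check P S) (generic_name P) p ->
  exists q, q ∈ P /\ le q p /\ le q S.
Proof.
intros Hp [H]; destruct (H p) as [q [Hq [Hqp [u [r [Hu [Hqr He]]]]]]]; auto.
unfold generic_name in Hu; rewrite in_setof in Hu;
  [|apply (is_set_image P (fun p => opair (check P p) p))].
destruct Hu as [r' [Hr' E]]; apply opair_inj in E; destruct E as [-> ->].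
exists q; split; [|split]; auto.
rewrite (forces_check_inj Hq (forces_eq_refl (check P S) q) He); auto.
Qed.

Lemma fex_ground_elim (phi : M -> forcing_statement M) p : p ∈ P ->
  fex_ground P le phi p -> exists q x, q ∈ P /\ le q p /\ phi x q.
Proof.
intros Hp H; destruct (H p) as [q [Hq [Hle [x [_ Hx]]]]]; auto.
exists q, x; auto.
Qed.

End Forcing.

(** * Well-foundedness of the generic ultrapower *)

Section Ultrapower.
Variables (M : universe) (delta P : M) (F : M -> M).
Hypothesis P_tower : tower delta P F.
Implicit Types p q r s t u x y z : M.

Local Notation le := (@tower_le M).
Local Notation feq := (forces_eq P le).
Local Notation fmem := (forces_mem P le).

Lemma tower_le_refl p : le p p.
Proof.
split; [intros z; auto|]; intros a Ha.
replace (cap a (bigcup p)) with a; auto; apply extensionality; intros z.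
rewrite in_cap, in_bigcup; split; [eauto | tauto].
Qed.

Lemma tower_le_trans p q r : le p q -> le q r -> le p r.
Proof.
intros [H1 H2] [H3 H4]; split; [intros z Hz; auto|]; intros a Ha.
replace (cap a (bigcup r)) with (cap (cap a (bigcup q)) (bigcup r)); auto.
apply extensionality; intros z; rewrite !in_cap; split; [tauto|].
intros [Hz1 Hz2]; auto.
Qed.

Hint Resolve tower_le_refl tower_le_trans : core.

(** A forced relation becomes actual membership: once q is below the set of a with f1(a ∩ X1) ∈ f2(a
    ∩ X2), each c in q projects into that set. Projecting to Z first is harmless because Z contains
    X1 and X2. *)
Lemma ultra_E_elim t1 t2 p : p ∈ P -> ultra_E delta P F t1 t2 p ->
  exists q X1 f1 X2 f2, q ∈ P /\ le q p /\
    ultra_function delta X1 f1 /\ ultra_function delta X2 f2 /\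
    feq t1 (check P f1) q /\ feq t2 (check P f2) q /\
    X1 ⊆ bigcup q /\ X2 ⊆ bigcup q /\
    forall c, c ∈ q -> app f1 (cap c X1) ∈ app f2 (cap c X2).
Proof.
intros Hp H; unfold ultra_E in H.
apply fex_ground_elim in H; auto; destruct H as [q1 [X1 [Hq1 [L1 H]]]].
apply fex_ground_elim in H; auto; destruct H as [q2 [f1 [Hq2 [L2 H]]]].
apply fex_ground_elim in H; auto; destruct H as [q3 [X2 [Hq3 [L3 H]]]].
apply fex_ground_elim in H; auto; destruct H as [q4 [f2 [Hq4 [L4 H]]]].
destruct H as [[U1 U2] [E1 [E2 H]]].
apply fex_ground_elim in H; auto; destruct H as [q5 [Z [Hq5 [L5 H]]]].
destruct H as [[HZ HXZ] [HS HG]].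
apply forces_generic in HG; eauto; destruct HG as [q6 [Hq6 [L6 LS]]].
exists q6, X1, f1, X2, f2.
assert (L64 : le q6 q4) by eauto.
assert (ES := positive_bigcup (tower_normal P_tower HZ) HS).
destruct LS as [LS1 LS2]; rewrite ES in LS1, LS2.
assert (H1 : X1 ⊆ Z) by (intros z Hz; apply HXZ, in_cup; auto).
assert (H2 : X2 ⊆ Z) by (intros z Hz; apply HXZ, in_cup; auto).
split; [|split; [eauto 7|split; [|split; [|split; [|split; [|split; [|split]]]]]]]; auto.
- apply forces_eq_mono with q4; eauto.
- apply forces_eq_mono with q4; eauto.
- intros z Hz; auto.
- intros z Hz; auto.
- intros c Hc; apply LS2, in_powsep in Hc; destruct Hc as [_ Hc].
  assert (Ec : forall X, X ⊆ Z -> cap (cap c Z) X = cap c X).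
  + intros X HX; apply extensionality; intros z; rewrite !in_cap; split; [tauto|].
    intros [Hz1 Hz2]; auto.
  + rewrite !Ec in Hc; auto.
Qed.

Record node_data : Type := NodeData {
  n_cond : M; n_name : M; n_dom : M; n_fun : M
}.

Variables (q A : M).
Hypothesis q_P : q ∈ P.
Hypothesis A_nonempty : fex_name P le (fun t => fmem t A) q.
Hypothesis A_ultrapower :
  fall_name P (fun t => fimp P le (fmem t A) (in_ultrapower delta P t)) q.
Hypothesis A_no_minimal : fnot P le (fex_name P le (fun t => fand (fmem t A)
  (fall_name P (fun u => fimp P le (fmem u A) (fnot P le (ultra_E delta P F u t)))))) q.

Definition valid (nu : node_data) : Prop :=
  n_cond nu ∈ P /\ le (n_cond nu) q /\ is_name P (n_name nu) /\
  fmem (n_name nu) A (n_cond nu) /\ ultra_function delta (n_dom nu) (n_fun nu) /\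
  feq (n_name nu) (check P (n_fun nu)) (n_cond nu).

(** [nu] is the earlier node: the function at [mu] represents the smaller element, and every element
    of the condition at [mu] witnesses this. The inclusions let a be replaced by its trace on the
    support of that condition. *)
Definition below (nu mu : node_data) : Prop :=
  n_dom nu ⊆ bigcup (n_cond mu) /\ n_dom mu ⊆ bigcup (n_cond mu) /\
  forall c, c ∈ n_cond mu -> app (n_fun mu) (cap c (n_dom mu)) ∈ app (n_fun nu) (cap c (n_dom nu)).

Lemma valid_root : exists nu, valid nu.
Proof.
destruct (A_nonempty q_P (tower_le_refl q)) as [q0 [Hq0 [L0 [t [Ht Hm]]]]].
(* Forced implication is the negation of a conjunction, so membership in the ultrapower is available
   only at some further extension. *)
destruct (classic (exists r, r ∈ P /\ le r q0 /\ in_ultrapower delta P t r))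
  as [[r [Hr [Lr H]]]|Hn].
- apply fex_ground_elim in H; auto; destruct H as [q1 [X [Hq1 [L1 H]]]].
  apply fex_ground_elim in H; auto; destruct H as [q2 [f [Hq2 [L2 [H1 H2]]]]].
  exists (NodeData q2 t X f); split; [|split; [|split; [|split; [|split]]]]; cbn; eauto.
  apply forces_mem_mono with q0; eauto.
- exfalso; apply (A_ultrapower Ht Hq0 L0); split; auto; intros r Hr Lr H; apply Hn; eauto.
Qed.

(** If no extension of U forced a name in A to be E-below the name at [nu], then U would force the
    latter to be minimal. The relation E supplies its own representative f2 of the old name; it
    equals the old function because a name is forced equal to at most one check name, and X2 is
    recovered from the domain P(X2). *)
Lemma valid_next nu U : valid nu -> U ∈ P -> le U (n_cond nu) ->
  exists mu, valid mu /\ le (n_cond mu) U /\ below nu mu.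
Proof.
destruct nu as [r t X f]; unfold valid, below; cbn.
intros [Hr [Lr [Ht [Hm [Hu He]]]]] HU LU.
assert (Hd : exists U' u, U' ∈ P /\ le U' U /\ is_name P u /\ fmem u A U' /\
  ultra_E delta P F u t U').
- apply NNPP; intros Hn; apply (A_no_minimal HU); [eauto|].
  intros q1 Hq1 L1; exists q1; split; [|split]; auto; exists t; split; auto; split.
  + apply forces_mem_mono with r; eauto.
  + intros u Hu' q2 Hq2 L2 [Hm2 Hnn]; apply (Hnn q2); auto.
    intros q3 Hq3 L3 HE; apply Hn; exists q3, u; split; [|split; [|split; [|split]]]; eauto.
    apply forces_mem_mono with q2; eauto.
- destruct Hd as [U' [u [HU' [LU' [Hnu [Hmu HE]]]]]].
  apply ultra_E_elim in HE; auto.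
  destruct HE as [s [X1 [f1 [X2 [f2 [Hs [Ls [H1 [H2 [E1 [E2 [S1 [S2 Hc]]]]]]]]]]]]].
  assert (Lr' : le s r) by eauto.
  assert (E : f2 = f).
  + apply (forces_check_inj tower_le_refl tower_le_trans Hs E2).
    apply forces_eq_mono with r; eauto.
  + subst f2; assert (E : X2 = X).
    * apply pow_inj, (function_on_domain (proj2 H2) (proj2 Hu)).
    * subst X2; exists (NodeData s u X1 f1); cbn.
      split; [split; [|split; [|split; [|split; [|split]]]]|split]; eauto.
      apply forces_mem_mono with U'; eauto.
Qed.

End Ultrapower.

Theorem theorem6p1 (M : universe) (delta lam P : M) (F : M -> M)
  (lam_card : is_cardinality lam (Vrank (succ (succ (add_omega delta)))))
  (delta_supercompact : supercompact delta lam)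
  (P_tower : tower delta P F)
  (F_club : forall X : M, X ∈ Vrank delta ->
     exists S : M, stationary X S /\ F X = restrict X (club_filter X) S) :
  precipitous delta P F.
Proof.
destruct delta_supercompact as [N [j [Nt [Hj [Hcrit [Hlam Hcl]]]]]].
(* Unfolding the forced implication leaves a condition q forcing that A is a nonempty set of
   elements of the ultrapower without a minimal one. *)
intros p Hp A HA q Hq _ [[H1 H2] H3].
set (node := {nu | valid delta P q A nu}).
(* The strategy has to be total, so the node itself is returned as a default for an illegal U. *)
assert (C : forall (nu : node) U, exists mu : node,
  U ∈ P -> tower_le U (n_cond (proj1_sig nu)) ->
  tower_le (n_cond (proj1_sig mu)) U /\ below (proj1_sig nu) (proj1_sig mu)).
{ intros [nu Hnu] U; cbn.
  destruct (classic (U ∈ P /\ tower_le U (n_cond nu))) as [[HU LU]|Hn].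
  - destruct (valid_next P_tower H3 Hnu HU LU) as [mu [Hmu H]].
    exists (exist _ mu Hmu); auto.
  - exists (exist _ nu Hnu); tauto. }
set (next := fun nu U => proj1_sig (constructive_indefinite_description _ (C nu U))).
assert (Hnext : forall nu U, U ∈ P -> tower_le U (n_cond (proj1_sig nu)) ->
  tower_le (n_cond (proj1_sig (next nu U))) U /\ below (proj1_sig nu) (proj1_sig (next nu U)))
  by (intros nu U; exact (proj2_sig (constructive_indefinite_description _ (C nu U)))).
destruct (valid_root Hq H1 H2) as [nu0 Hnu0].
destruct (@tower_branch M delta lam N j (tower_limit P_tower) lam_card Nt Hj Hcrit Hlam Hcl
  P F P_tower F_club node (fun nu => n_cond (proj1_sig nu)) next (exist _ nu0 Hnu0))
  as [nu [U [a [_ Hnu]]]].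
- intros [mu Hmu]; apply Hmu.
- intros mu U HU LU; apply Hnext; auto.
- apply (@no_descending M (fun n => app (n_fun (proj1_sig (nu n)))
    (cap a (n_dom (proj1_sig (nu n)))))); intros n.
  destruct (Hnu n) as [HU [LU [E _]]], (Hnu (S n)) as [_ [_ [_ Ht]]].
  destruct (Hnext (nu n) (U n) HU LU) as [_ [D1 [D2 Hc]]].
  (* The set a traces into the condition of node n + 1, each element of which realizes the descent
     from node n. *)
  rewrite <- E in D1, D2, Hc; apply Hc in Ht.
  assert (Ec : forall X, X ⊆ bigcup (n_cond (proj1_sig (nu (S n)))) ->
    cap (cap a (bigcup (n_cond (proj1_sig (nu (S n)))))) X = cap a X).
  + intros X HX; apply extensionality; intros z; rewrite !in_cap; split; [tauto|].
    intros [Hz1 Hz2]; auto.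
  + rewrite !Ec in Ht; auto.
Qed.
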